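(* Let $X,\Gamma\subset\mathbb{P}^r$ be closed subschemes such that $X$ is nondegenerate and $\Gamma$ is reduced with every irreducible component spanning all of $\mathbb{P}^r$. Let $p\ge 0$ be an integer. If the natural map $$\operatorname{Tor}^S_p(I_{X\cup\Gamma},k)_{p+2}\to\operatorname{Tor}^S_p(I_X,k)_{p+2}$$ is not surjective, then $$\dim_k\frac{H^0(\mathcal{I}_{X\cap\Gamma}(2))}{H^0(\mathcal{I}_\Gamma(2))}>p.$$
   Context: $k$ is an algebraically closed field, $S=k[x_0,\dots,x_r]$ and $\mathbb{P}^r=\operatorname{Proj}S$. For a closed subscheme $Y\subset\mathbb{P}^r$, $\mathcal{I}_Y$ is its ideal sheaf and $I_Y\subset S$ its saturated homogeneous ideal; $Y$ is nondegenerate if $I_Y$ contains no nonzero linear form. $X\cup\Gamma$ is the scheme with ideal sheaf $\mathcal{I}_X\cap\mathcal{I}_\Gamma$ and $X\cap\Gamma$ the scheme with ideal sheaf $\mathcal{I}_X+\mathcal{I}_\Gamma$. The natural map on $\operatorname{Tor}$ is induced by the inclusion $I_{X\cup\Gamma}\subset I_X$, and the subscript $p+2$ denotes the graded piece of degree $p+2$. *)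

(* Defs.v *)
From HB Require Import structures.
From mathcomp Require Import all_boot all_order all_algebra.
From mathcomp Require Export mpoly.

Set Implicit Arguments.
Unset Strict Implicit.
Unset Printing Implicit Defensive.

Import GRing.Theory.
Local Open Scope ring_scope.

Definition is_ideal (A : comNzRingType) (I : A -> Prop) : Prop :=
  [/\ I 0, forall a b, I a -> I b -> I (a + b) & forall a b, I b -> I (a * b)].

Section ProjectiveSpace.

Variables (k : closedFieldType) (r : nat).

Notation S := {mpoly k[r.+1]}.
(* The coordinate ring k[x_j / x_i | j != i] of the standard chart D+(x_i). *)
Notation A := {mpoly k[r]}.

(* For f homogeneous of degree d, dehom i f is f / x_i ^ d in the coordinate
   ring of D+(x_i). *)
Definition dehom (i : 'I_r.+1) (f : S) : A :=
  f \mPo [tuple (if unlift i j is Some j' then 'X_j' else 1) | j < r.+1].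

(* For I an ideal on D+(x_i) and f homogeneous of degree d, this says that
   f / x_i ^ d lies in the localization of I at x_j / x_i, that is, in the
   restriction of I to D+(x_i x_j). *)
Definition in_overlap (i j : 'I_r.+1) (I : A -> Prop) (f : S) : Prop :=
  exists n, I (dehom i ('X_j ^+ n * f)).

(* A closed subscheme of P^r is given by its quasi-coherent ideal sheaf: one
   ideal on each standard chart, with equal restrictions to the overlaps.
   There f / x_i ^ d and f / x_j ^ d differ by a unit. *)
Record closed_subscheme := ClosedSubscheme {
  chart :> 'I_r.+1 -> A -> Prop;
  chart_ideal : forall i, is_ideal (chart i);
  chart_glue : forall i j d f, f \is d.-homog ->
    in_overlap i j (chart i) f <-> in_overlap j i (chart j) f }.

(* H^0(I_Y(d)), inside H^0(O(d)) = S_d *)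
Definition H0 (Y : closed_subscheme) (d : nat) (f : S) : Prop :=
  f \is d.-homog /\ forall i, Y i (dehom i f).

(* The saturated homogeneous ideal, i.e. the direct sum of the H^0(I_Y(d)) *)
Definition satideal (Y : closed_subscheme) (f : S) : Prop :=
  forall d, H0 Y d (pihomog mdeg d f).

Definition is_nondegenerate (Y : closed_subscheme) : Prop :=
  forall l, l \is 1.-homog -> satideal Y l -> l = 0.

Definition is_reduced (Y : closed_subscheme) : Prop :=
  forall i (f : A) n, Y i (f ^+ n) -> Y i f.

Definition schemeU_chart (Y Z : closed_subscheme) (i : 'I_r.+1) (f : A) :
    Prop :=
  Y i f /\ Z i f.

Definition schemeI_chart (Y Z : closed_subscheme) (i : 'I_r.+1) (f : A) :
    Prop :=
  exists g h, [/\ Y i g, Z i h & f = g + h].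

Lemma dehomM i f g : dehom i (f * g) = dehom i f * dehom i g.
Proof. by rewrite /dehom rmorphM. Qed.

Lemma dehomD i f g : dehom i (f + g) = dehom i f + dehom i g.
Proof. by rewrite /dehom rmorphD. Qed.

Lemma dehomXi i n : dehom i ('X_i ^+ n) = 1.
Proof.
rewrite /dehom rmorphXn /= comp_mpolyXU -tnth_nth tnth_mktuple unlift_none.
by rewrite expr1n.
Qed.

Lemma in_overlap_mono (Y : closed_subscheme) i j f n m : (n <= m)%N ->
  Y i (dehom i ('X_j ^+ n * f)) -> Y i (dehom i ('X_j ^+ m * f)).
Proof.
move=> /subnK <- Yf; rewrite exprD -mulrA dehomM.
by have [_ _ mulY] := chart_ideal Y i; apply: mulY.
Qed.

Lemma schemeU_ideal Y Z i : is_ideal (schemeU_chart Y Z i).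
Proof.
have [Y0 YD YM] := chart_ideal Y i; have [Z0 ZD ZM] := chart_ideal Z i.
by split=> [|a b [? ?] [? ?]|a b [? ?]]; split; auto.
Qed.

Lemma schemeU_glue Y Z i j d f : f \is d.-homog ->
  in_overlap i j (schemeU_chart Y Z i) f <->
  in_overlap j i (schemeU_chart Y Z j) f.
Proof.
suff h i' j' : f \is d.-homog -> in_overlap i' j' (schemeU_chart Y Z i') f ->
  in_overlap j' i' (schemeU_chart Y Z j') f by split; apply: h.
move=> fd [n [Yf Zf]].
have [] := chart_glue Y i' j' fd; move=> /(_ (ex_intro _ n Yf))[a Ya] _.
have [] := chart_glue Z i' j' fd; move=> /(_ (ex_intro _ n Zf))[b Zb] _.
exists (a + b)%N; split; first exact: in_overlap_mono (leq_addr _ _) Ya.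
exact: in_overlap_mono (leq_addl _ _) Zb.
Qed.

Definition schemeU Y Z : closed_subscheme :=
  ClosedSubscheme (schemeU_ideal Y Z) (@schemeU_glue Y Z).

Lemma schemeI_ideal Y Z i : is_ideal (schemeI_chart Y Z i).
Proof.
have [Y0 YD YM] := chart_ideal Y i; have [Z0 ZD ZM] := chart_ideal Z i.
split=> [|a b [g [h [Yg Zh ->]]] [g' [h' [Yg' Zh' ->]]]|a b [g [h [Yg Zh ->]]]].
- by exists 0, 0; rewrite addr0.
- by exists (g + g'), (h + h'); rewrite addrACA; split; auto.
- by exists (a * g), (a * h); rewrite mulrDr; split; auto.
Qed.

Definition lift_chart (i : 'I_r.+1) (g : A) : S :=
  g \mPo [tuple 'X_(lift i j) | j < r].

Definition homogenize (i : 'I_r.+1) (D : nat) (g : A) : S :=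
  \sum_(e < D.+1) pihomog mdeg e (lift_chart i g) * 'X_i ^+ (D - e).

Lemma Xhomog (i : 'I_r.+1) n : ('X_i ^+ n : S) \is n.-homog.
Proof.
by rewrite -{2}[n]mul1n; apply: (@dhomogMn _ _ mdeg); rewrite dhomogX /= mdeg1.
Qed.

Lemma homogenize_homog i D g : homogenize i D g \is D.-homog.
Proof.
rewrite /homogenize; apply: rpred_sum => e _.
have eD : (e <= D)%N by rewrite -ltnS.
have := dhomogM (pihomogP mdeg e (lift_chart i g)) (Xhomog i (D - e)).
by rewrite subnKC.
Qed.

Lemma dehom_lift i g : dehom i (lift_chart i g) = g.
Proof.
rewrite /lift_chart comp_mpolyEX /dehom linear_sum /= [RHS]mpolyE.
apply: eq_bigr => m _; rewrite linearZ /= comp_mpolyX rmorph_prod /=.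
congr (_ *: _); rewrite mpolyXE_id; apply: eq_bigr => j _.
by rewrite tnth_mktuple rmorphXn /= comp_mpolyXU -tnth_nth tnth_mktuple liftK.
Qed.

Lemma homogenizeK i g : exists D, dehom i (homogenize i D g) = g.
Proof.
exists (msize (lift_chart i g)); set D := msize _.
rewrite -[RHS](dehom_lift i).
have /(@pihomog_partitionE _ _ mdeg) E : (msize (lift_chart i g) <= D.+1)%N.
  exact: leqnSn.
rewrite [in RHS]E /homogenize /dehom !linear_sum /=; apply: eq_bigr => e _.
by rewrite -!/(dehom _ _) dehomM dehomXi mulr1.
Qed.

Lemma homogenize_sum i D (I : Type) (s : seq I) (c : I -> k) (g : I -> A) :
  homogenize i D (\sum_(x <- s) c x *: g x) =
  \sum_(x <- s) c x *: homogenize i D (g x).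
Proof.
rewrite /homogenize; have -> : lift_chart i (\sum_(x <- s) c x *: g x) =
    \sum_(x <- s) c x *: lift_chart i (g x).
  rewrite /lift_chart linear_sum; apply: eq_bigr => x _; exact: linearZ.
under [RHS]eq_bigr do rewrite scaler_sumr.
rewrite [RHS]exchange_big /=; apply: eq_bigr => e _.
rewrite linear_sum mulr_suml; apply: eq_bigr => x _.
by rewrite linearZ /= scalerAl.
Qed.

Lemma homogenize_dehom i D F : F \is D.-homog -> homogenize i D (dehom i F) = F.
Proof.
move=> /dhomogP FD; rewrite [F in LHS]mpolyE [RHS]mpolyE.
have -> : dehom i (\sum_(m <- msupp F) F@_m *: 'X_[m]) =
    \sum_(m <- msupp F) F@_m *: dehom i 'X_[m].
  rewrite /dehom linear_sum; apply: eq_bigr => m _; exact: linearZ.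
rewrite homogenize_sum big_seq [RHS]big_seq; apply: eq_bigr => m /FD mD.
congr (_ *: _); pose Q : S := \prod_(j | j != i) 'X_j ^+ m j.
pose e0 := (\sum_(j | j != i) m j)%N.
have De0 : D = (m i + e0)%N by rewrite -mD /= mdegE (bigD1 i).
have XQ : 'X_[m] = 'X_i ^+ m i * Q by rewrite mpolyXE_id (bigD1 i).
have Qe0 : Q \is e0.-homog.
  rewrite /Q /e0; elim/big_ind2: _ => [|? ? ? ? ? ?|j _].
  - exact: dhomog1.
  - exact: dhomogM.
  - exact: Xhomog.
have liftQ : lift_chart i (dehom i 'X_[m]) = Q.
  rewrite XQ dehomM dehomXi mul1r /lift_chart /dehom /Q !rmorph_prod /=.
  apply: eq_bigr => j; rewrite eq_sym => /unlift_some[j' jj' uj].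
  rewrite !rmorphXn /= comp_mpolyXU -tnth_nth tnth_mktuple uj.
  by rewrite comp_mpolyXU -tnth_nth tnth_mktuple -jj'.
rewrite /homogenize liftQ.
have e0D : (e0 < D.+1)%N by rewrite ltnS De0 leq_addl.
rewrite (bigD1 (Ordinal e0D)) //= big1 => [|e ne].
  by rewrite addr0 pihomog_dE // De0 addnK mulrC -XQ.
rewrite (@pihomog_ne0 _ _ _ e0) ?mul0r // eq_sym.
by apply: contra ne => /eqP ne; apply/eqP/val_inj.
Qed.

Lemma schemeI_glue Y Z i j d f : f \is d.-homog ->
  in_overlap i j (schemeI_chart Y Z i) f <->
  in_overlap j i (schemeI_chart Y Z j) f.
Proof.
suff h i' j' : f \is d.-homog -> in_overlap i' j' (schemeI_chart Y Z i') f ->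
  in_overlap j' i' (schemeI_chart Y Z j') f by split; apply: h.
move=> fd [n [g [h [Yg Zh fgh]]]] {i j}; move: i' j' => i j in Yg Zh fgh *.
have [da [G [Ga Gg]]] : exists da G, G \is da.-homog /\ dehom i G = g.
  have [da gK] := homogenizeK i g.
  by exists da, (homogenize i da g); split; first exact: homogenize_homog.
have [db [H [Hb Hh]]] : exists db H, H \is db.-homog /\ dehom i H = h.
  have [db hK] := homogenizeK i h.
  by exists db, (homogenize i db h); split; first exact: homogenize_homog.
have E : 'X_i ^+ (da + db) * ('X_j ^+ n * f) =
    'X_i ^+ (db + (n + d)) * G + 'X_i ^+ (da + (n + d)) * H.
  have LD : 'X_i ^+ (da + db) * ('X_j ^+ n * f)
      \is ((da + db) + (n + d)).-homog.
    by do 2 (apply: dhomogM; first exact: Xhomog).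
  have RD : 'X_i ^+ (db + (n + d)) * G + 'X_i ^+ (da + (n + d)) * H
      \is ((da + db) + (n + d)).-homog.
    apply: rpredD.
      have -> : ((da + db) + (n + d) = (db + (n + d)) + da)%N.
        by rewrite -addnA [RHS]addnC.
      by apply: dhomogM => //; exact: Xhomog.
    have -> : ((da + db) + (n + d) = (da + (n + d)) + db)%N by rewrite addnAC.
    by apply: dhomogM => //; exact: Xhomog.
  rewrite -(homogenize_dehom i LD) -(homogenize_dehom i RD); congr homogenize.
  by rewrite dehomD !dehomM !dehomXi !mul1r Gg Hh -dehomM.
have [] := chart_glue Y i j Ga => + _; case=> [|u Yu].
  by exists 0; rewrite expr0 mul1r Gg.
have [] := chart_glue Z i j Hb => + _; case=> [|v Zv].
  by exists 0; rewrite expr0 mul1r Hh.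
pose w := (u + v + (da + db))%N; exists w.
have [_ _ YM] := chart_ideal Y j; have [_ _ ZM] := chart_ideal Z j.
exists (dehom j ('X_i ^+ (v + (db + (n + d))) * ('X_i ^+ u * G))).
exists (dehom j ('X_i ^+ (u + (da + (n + d))) * ('X_i ^+ v * H))).
split; [by rewrite dehomM; apply: YM | by rewrite dehomM; apply: ZM |].
have -> : dehom j ('X_i ^+ w * f) = dehom j ('X_i ^+ w * ('X_j ^+ n * f)).
  by rewrite !dehomM dehomXi mul1r.
rewrite -dehomD /w exprD -mulrA E; congr dehom.
rewrite mulrDr !mulrA -!exprD; congr ('X_i ^+ _ * _ + 'X_i ^+ _ * _).
  by rewrite -addnA [RHS]addnC.
by rewrite addnAC.
Qed.

Definition schemeI Y Z : closed_subscheme :=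
  ClosedSubscheme (schemeI_ideal Y Z) (@schemeI_glue Y Z).

Lemma H0_schemeI_sub (Y Z : closed_subscheme) d f :
  H0 Z d f -> H0 (schemeI Y Z) d f.
Proof.
move=> [fd Zf]; split=> // i; exists 0, (dehom i f).
by rewrite add0r; split=> //; have [] := chart_ideal Y i.
Qed.

Lemma satideal_schemeU_sub (Y Z : closed_subscheme) f :
  satideal (schemeU Y Z) f -> satideal Y f.
Proof. by move=> Yf d; have [? h] := Yf d; split=> // i; have [] := h i. Qed.

(* The points of Proj S *)
Record proj_point := ProjPoint {
  point_ideal :> S -> Prop;
  point_is_ideal : is_ideal point_ideal;
  point_homog : forall f d, point_ideal f -> point_ideal (pihomog mdeg d f);
  point_proper : ~ point_ideal 1;
  point_prime : forall f g,
    point_ideal (f * g) -> point_ideal f \/ point_ideal g;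
  point_relevant : exists i, ~ point_ideal 'X_i }.

Definition zariski_closed (C : proj_point -> Prop) : Prop :=
  exists T : S -> Prop, (forall f, T f -> exists d, f \is d.-homog) /\
    forall P : proj_point, C P <-> forall f, T f -> P f.

Definition irreducible (Z : proj_point -> Prop) : Prop :=
  (exists P, Z P) /\
  forall C D, zariski_closed C -> zariski_closed D ->
    (forall P, Z P -> C P \/ D P) ->
    (forall P, Z P -> C P) \/ (forall P, Z P -> D P).

(* The underlying set of Y = Proj (S / I_Y), i.e. V(I_Y) *)
Definition scheme_support (Y : closed_subscheme) (P : proj_point) : Prop :=
  forall f, satideal Y f -> P f.

Definition irreducible_component (Y : closed_subscheme)
    (Z : proj_point -> Prop) : Prop :=
  [/\ irreducible Z, forall P, Z P -> scheme_support Y P &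
      forall W, irreducible W -> (forall P, W P -> scheme_support Y P) ->
        (forall P, Z P -> W P) -> forall P, W P -> Z P].

Definition spans (Z : proj_point -> Prop) : Prop :=
  forall l : S, l \is 1.-homog -> (forall P, Z P -> P l) -> l = 0.

(* A graded resolution of k = S / (x_0, .., x_r) by free modules
     F_i = \bigoplus_(a < rk i) S (- dg i a).
   Elements of F_i are row vectors, and the maps multiply on the right. The
   augmentation F_0 -> k sends the a-th basis vector to aug a, and S acts on k
   through the constant coefficient. *)
Record free_resolution := FreeResolution {
  rk : nat -> nat;
  dg : forall i, 'I_(rk i) -> int;
  differential : forall i, 'M[S]_(rk i.+1, rk i);
  aug : 'cV[k]_(rk 0);
  differential_homog : forall i a b m, m \in msupp (differential i a b) ->
    (mdeg m)%:Z + dg b = dg a;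
  aug_homog : forall a, aug a 0 != 0 -> dg a = 0;
  aug_surj : exists v : 'rV[S]_(rk 0), map_mx (mcoeff 0%MM) v *m aug = 1%:M;
  exact_aug : forall v : 'rV[S]_(rk 0),
    map_mx (mcoeff 0%MM) v *m aug = 0 <-> exists w, v = w *m differential 0;
  exact_differential : forall i (v : 'rV[S]_(rk i.+1)),
    v *m differential i = 0 <-> exists w, v = w *m differential i.+1 }.

Section Tor.

Variable F : free_resolution.

(* Tor_i (J, k) is the left derived functor of J \otimes_S - at k. For J a
   homogeneous ideal of S, tor_chain is the degree n piece of
     J \otimes F_i = \bigoplus_a J (- dg i a),
   the row vectors with entries in J. The differential is the restriction of
   that of F, and Tor_i (J, k)_n is the homology, tor_cycle / tor_boundary. *)
Definition tor_chain (J : S -> Prop) (i : nat) (n : int)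
    (v : 'rV[S]_(rk F i)) : Prop :=
  forall a, J (v 0 a) /\
    forall m, m \in msupp (v 0 a) -> (mdeg m)%:Z + dg a = n.

Definition is_cycle (i : nat) : 'rV[S]_(rk F i) -> Prop :=
  match i with
  | 0 => fun=> True
  | i'.+1 => fun v => v *m differential F i' = 0
  end.

Definition tor_cycle J i n (v : 'rV[S]_(rk F i)) : Prop :=
  tor_chain J n v /\ is_cycle v.

Definition tor_boundary J i n (v : 'rV[S]_(rk F i)) : Prop :=
  exists2 w, tor_chain J n w & v = w *m differential F i.

(* For J included in J', surjectivity of Tor_i (J, k)_n -> Tor_i (J', k)_n *)
Definition tor_map_surjective (J J' : S -> Prop) (i : nat) (n : int) : Prop :=
  forall v : 'rV[S]_(rk F i), tor_cycle J' n v ->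
    exists2 u, tor_cycle J n u & tor_boundary J' n (v - u).

End Tor.

(* For subspaces U of W, dim_k (W / U) = d: the classes of e_0, .., e_(d-1)
   form a basis of W / U. *)
Definition quotient_dim (W U : S -> Prop) (d : nat) : Prop :=
  exists e : 'I_d -> S,
    [/\ forall i, W (e i),
        forall c : 'I_d -> k, U (\sum_i c i *: e i) -> forall i, c i = 0 &
        forall f, W f -> exists c : 'I_d -> k, U (f - \sum_i c i *: e i)].

End ProjectiveSpace.

(* Main.v *)
Require Import Defs.
From mathcomp Require Import all_boot all_order all_algebra.
From mathcomp Require Import boolp.
From mathcomp Require classical_sets.

(* Tor can be computed with a linear free resolution G of k, the Koszul
   complex. Since G_p is generated in degree p, a Tor_p class of I_X in degree
   p + 2 is a cycle sum_i q_i tau_i with q_i in (I_X)_2 and tau_i a constant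
   vector. If it is not a cycle of I_(X u Gamma), some coefficient lies outside
   I_Gamma, hence outside a minimal prime P of I_Gamma; let Z be the set of
   k-points of the affine cone of P. By the Nullstellensatz Z is irreducible and
   spans, and there Green's vanishing argument applies: were the space of
   quadrics modulo I_Gamma of dimension w <= p, contracting the cycle with w
   general points of Z would leave a cycle with coefficients in a zero space, so
   the cycle would vanish on Z. *)

Set Implicit Arguments.
Unset Strict Implicit.
Unset Printing Implicit Defensive.

Import GRing.Theory.
Local Open Scope ring_scope.

(** * Nullstellensatz for prime ideals *)

(** The coefficients of a cycle are expanded in quadrics that form a basis modulo $I_\Gamma$. This
    expansion is a cycle only at points where $I_\Gamma$ vanishes, not over [S]; hence the vanishing
    argument works with values at k-points, and P has to be recovered from its zeros. Irreducibility
    carries an identity from the points where a chosen quadric is nonzero to all of Z, and spanning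
    kills a linear form that vanishes on Z. Each contraction lowers p and w together, so w <= p is
    the right bound: at p = 0 no quadric is left. *)

Definition is_prime_ideal (A : comNzRingType) (P : A -> Prop) : Prop :=
  [/\ is_ideal P, ~ P 1 & forall a b, P (a * b) -> P a \/ P b].

Lemma ex_min_nat (Q : nat -> Prop) :
  (exists n, Q n) -> exists2 n, Q n & forall m, Q m -> (n <= m)%N.
Proof.
move=> exQ; have exQ' : exists n, `[< Q n >].
  by case: exQ => n /asboolP; exists n.
by case: (ex_minnP exQ') => n /asboolP Qn nmin; exists n => // m /asboolP/nmin.
Qed.

Lemma ex_max_nat (Q : nat -> Prop) b : (forall n, Q n -> (n <= b)%N) ->
  (exists n, Q n) -> exists2 n, Q n & forall m, Q m -> (m <= n)%N.
Proof.
move=> Qb exQ; have exQ' : exists n, `[< Q n >].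
  by case: exQ => n /asboolP; exists n.
have Qb' n : `[< Q n >] -> (n <= b)%N by move=> /asboolP/Qb.
case: (ex_maxnP exQ' Qb') => n /asboolP Qn nmax.
by exists n => // m /asboolP/nmax.
Qed.

Section Ideals.

Variables (A : comNzRingType) (I : A -> Prop).
Hypothesis idI : is_ideal I.

Lemma ideal0 : I 0. Proof. by case: idI. Qed.

Lemma idealD a b : I a -> I b -> I (a + b).
Proof. by case: idI => _ + _; apply. Qed.

Lemma idealMl a b : I b -> I (a * b). Proof. by case: idI => _ _; apply. Qed.

Lemma idealMr a b : I a -> I (a * b).
Proof. by rewrite mulrC; apply: idealMl. Qed.

Lemma idealN a : I a -> I (- a). Proof. by rewrite -mulN1r; apply: idealMl. Qed.

Lemma idealB a b : I a -> I b -> I (a - b).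
Proof. by move=> Ia /idealN; apply: idealD. Qed.

Lemma ideal_sum (T : Type) (s : seq T) (Q : pred T) (F : T -> A) :
  (forall x, Q x -> I (F x)) -> I (\sum_(x <- s | Q x) F x).
Proof. by move=> IF; elim/big_ind: _ => //; [exact: ideal0|exact: idealD]. Qed.

Lemma ideal_sum_seq (T : eqType) (s : seq T) (Q : pred T) (F : T -> A) :
  (forall x, x \in s -> Q x -> I (F x)) -> I (\sum_(x <- s | Q x) F x).
Proof.
by move=> IF; rewrite big_seq_cond; apply: ideal_sum => x /andP[]; apply: IF.
Qed.

End Ideals.

Lemma prime_ideal_preim (A B : comNzRingType) (h : A -> B) (P : B -> Prop) :
    h 1 = 1 -> {morph h : a b / a + b} -> {morph h : a b / a * b} ->
  is_prime_ideal P -> is_prime_ideal (fun a => P (h a)).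
Proof.
move=> h1 hD hM [idP nP1 prP].
have h0 : h 0 = 0 by apply: (addIr (h 0)); rewrite -hD !add0r.
split=> [||a b]; rewrite ?h1 ?hM //; last exact: prP.
split=> [|a b|a b]; rewrite ?h0 ?hD ?hM; first exact: ideal0.
  exact: idealD.
exact: idealMl.
Qed.

Section Specialization.

Variables (A : idomainType) (k : closedFieldType) (P : {poly A} -> Prop).
Hypothesis primeP : is_prime_ideal P.

Let idP : is_ideal P. Proof. by case: primeP. Qed.
Let P_0 : P 0 := ideal0 idP.

(** This is the ideal of A[t] generated by the contraction of P to A. The specialization argument
    splits according to whether P equals it or is strictly larger. *)
Let coefs_in (h : {poly A}) := forall i, P (h`_i)%:P.

Lemma coefs_in_prime h : coefs_in h -> P h.
Proof.
move=> hP; rewrite -[h]coefK poly_def; apply: ideal_sum => // i _.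
by rewrite -mul_polyC; apply: idealMr.
Qed.

(** [g] plays the minimal polynomial over the fraction field of A modulo the contraction of P.
    Pseudo-division replaces inverting its leading coefficient, which is only known to lie outside
    P. *)
Lemma ex_minimal_poly (I : {poly A} -> Prop) :
    is_ideal I -> (forall h, P h -> I h) -> (exists2 h, I h & ~ coefs_in h) ->
  exists g, [/\ I g, ~ P (lead_coef g)%:P &
    forall r, I r -> (size r < size g)%N -> coefs_in r].
Proof.
move=> idI PI [h Ih nh].
have trunc h' : ~ coefs_in h' -> I h' -> exists g,
    [/\ I g, ~ P (lead_coef g)%:P & (size g <= size h')%N].
  move=> /existsNP ex Ih'.
  have [i|i nPi imax] := ex_max_nat (b := size h') _ ex.
    move=> nP; rewrite leqNgt; apply/negP => /ltnW lei.
    by apply: nP; rewrite nth_default.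
  (* Cut above the last coefficient outside P: the discarded terms have coefficients in P, so they
     lie in I. *)
  exists (take_poly i.+1 h').
  have hi0 : h'`_i != 0 by apply/eqP => hi0; apply: nPi; rewrite hi0.
  have ih : (i < size h')%N.
    by rewrite ltnNge; apply: contra hi0 => ?; rewrite nth_default.
  split; last first.
  - by rewrite (leq_trans (size_take_poly _ _)).
  - by rewrite /take_poly lead_coef_poly.
  rewrite -[take_poly _ _](subKr h'); apply: (idealB idI) => //; apply: PI.
  apply: coefs_in_prime => j; rewrite coefB coef_take_poly ltnS.
  case: leqP => ji; first by rewrite subrr.
  rewrite subr0; apply: contrapT => /imax; by rewrite leqNgt ji.
have [] := @ex_min_nat (fun n =>
    exists g, [/\ I g, ~ P (lead_coef g)%:P & size g = n]).
  by have [g [? ? _]] := trunc _ nh Ih; exists (size g), g.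
move=> _ [g [Ig nPg <-]] gmin; exists g; split=> // r Ir rg.
apply: contrapT => /trunc/(_ Ir)[g' [Ig' nPg' g'r]].
have /gmin : exists g, [/\ I g, ~ P (lead_coef g)%:P & size g = size g'].
  by exists g'.
by rewrite leqNgt (leq_ltn_trans g'r).
Qed.

Lemma prime_exp a n : P ((a ^+ n)%:P) -> P a%:P.
Proof.
elim: n => [|n IHn]; first by rewrite expr0 => P1; case: primeP.
by rewrite exprS polyCM; case: primeP => _ _ pr /pr[].
Qed.

(* The generic point of V(P) specializes: wherever b does not vanish, a point
   of the base lifts to a point of V(P) off the hypersurface f = 0. *)
Lemma prime_poly_specialization f : ~ P f ->
  exists2 b, ~ P b%:P & forall ev : {rmorphism A -> k},
    (forall c, P c%:P -> ev c = 0) -> ev b != 0 ->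
    exists2 t, (forall h, P h -> (map_poly ev h).[t] = 0) &
      (map_poly ev f).[t] != 0.
Proof.
move=> nPf; have ev_coefs (ev : {rmorphism A -> k}) h :
    (forall c, P c%:P -> ev c = 0) -> coefs_in h -> map_poly ev h = 0.
  by move=> evP hP; apply/polyP => i; rewrite coef_map coef0 /= evP.
(* If P is extended from A, any t off the roots of f will do, and b is a coefficient of f outside P.
   Otherwise t is a root of a minimal g in P. *)
have [/(_ _ _)allP|/existsNP[h0 /not_implyP[Ph0 nh0]]] :=
    EM (forall h, P h -> coefs_in h).
  have /existsNP[i nPi] : ~ coefs_in f by move/coefs_in_prime.
  exists f`_i => // ev evP evi.
  have /closed_nonrootP[t ft] : map_poly ev f != 0.
    by apply: contra evi => /eqP f0; rewrite -coef_map /= f0 coef0.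
  by exists t => // h /allP/ev_coefs ->; rewrite ?horner0.
have [] := @ex_minimal_poly P idP _ (ex_intro2 _ _ h0 Ph0 nh0) => // g.
move=> [Pg nPg gmin]; have g0 : g != 0.
  by apply/eqP => g0; apply: nPg; rewrite g0 lead_coef0.
(* J = P + (f). Its minimal element c turns out to be constant, which is a Bezout identity for f
   modulo P. *)
pose J h := exists u, P (h - u * f).
have PJ h : P h -> J h by move=> Ph; exists 0; rewrite mul0r subr0.
have idJ : is_ideal J.
  split=> [|a b [u Pu] [v Pv]|a b [u Pu]]; first exact: PJ.
  - exists (u + v); have -> : a + b - (u + v) * f = (a - u * f) + (b - v * f).
      by rewrite mulrDl opprD addrACA.
    exact: idealD.
  - by exists (a * u); rewrite -mulrA -mulrBr; apply: idealMl.
have [] := @ex_minimal_poly J idJ PJ.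
  exists f; last by move/coefs_in_prime.
  by exists 1; rewrite mul1r subrr.
move=> c [[u Pcu] nPc cmin].
have c0 : c != 0 by apply/eqP => c0; apply: nPc; rewrite c0 lead_coef0.
have Jc : J c by exists u.
have modE (p q : {poly A}) :
    p %% q = (lead_coef q ^+ scalp p q)%:P * p - p %/ q * q.
  by rewrite mul_polyC polydiv.Pdiv.Idomain.divp_eq addrAC subrr add0r.
have modJ h : J h -> P (h %% c).
  move=> Jh; apply: coefs_in_prime; apply: cmin; last by rewrite ltn_modp.
  by rewrite modE; apply: (idealB idJ); apply: (idealMl idJ).
have nPexp a n : ~ P a%:P -> ~ P ((a ^+ n)%:P) by move=> nPa /prime_exp.
have sc1 : size c = 1%N.
  (* If c had positive degree, it would lie outside P and divide a multiple of g modulo P. The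
     quotient would be in P and shorter than g, so its leading coefficient would be in P, forcing
     that of g into P. *)
  apply/eqP; rewrite eqn_leq size_poly_gt0 c0 andbT leqNgt; apply/negP => sc.
  have nPc' : ~ P c.
    move=> Pc; apply: nPf.
    have : P ((lead_coef c ^+ scalp f c)%:P * f).
      rewrite mul_polyC polydiv.Pdiv.Idomain.divp_eq; apply: idealD => //.
        exact: idealMl.
      by apply: modJ; exists 1; rewrite mul1r subrr.
    by case: primeP => _ _ pr /pr[] // /nPexp.
  have : P (g %/ c * c).
    rewrite -[g %/ c * c](subKr ((lead_coef c ^+ scalp g c)%:P * g)) -modE.
    by apply: idealB => //; [apply: idealMl|apply/modJ/PJ].
  case: primeP => _ _ pr /pr[] // Pq.
  have cg : (size c <= size g)%N.
    rewrite leqNgt; apply/negP => /(cmin _ (PJ _ Pg)) gP; apply: nPg.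
    exact: gP.
  have sq : (size (g %/ c)%R < size g)%N.
    rewrite polydiv.Pdiv.Idomain.size_divp //.
    by rewrite ltn_subrL -subn1 subn_gt0 sc size_poly_gt0.
  have Plq : P (lead_coef (g %/ c))%:P by apply: gmin.
  have q0 : g %/ c != 0.
    by rewrite polydiv.Pdiv.Idomain.divp_eq0 !negb_or g0 c0 -leqNgt.
  have : P ((lead_coef c ^+ scalp g c)%:P * (lead_coef g)%:P).
    rewrite -polyCM -lead_coefZ polydiv.Pdiv.Idomain.divp_eq lead_coefDl.
      by rewrite lead_coefM polyCM; apply: idealMr.
    rewrite (@leq_trans (size c)) ?ltn_modp // size_mul //.
    rewrite -subn1 leq_subRL ?leq_add2r ?size_poly_gt0 //.
    by rewrite addn_gt0 size_poly_gt0 q0.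
  by case: primeP => _ _ pr' /pr'[] // /nPexp.
have /eqP/size_poly1P[c1 c10 Ec] := sc1.
rewrite Ec lead_coefC in nPc.
(* A nonzero image of [lead_coef g] preserves the degree of g, which gives a root; a nonzero image
   of [c1] keeps f nonzero there, as [c1] is u * f modulo P. *)
exists (lead_coef g * c1) => [|ev evP].
  by rewrite polyCM; case: primeP => _ _ pr /pr[].
rewrite rmorphM mulf_eq0 negb_or => /andP[evg evc].
have sg : size (map_poly ev g) = size g by rewrite size_map_poly_id0.
have /closed_rootP[t /rootP gt] : size (map_poly ev g) != 1%N.
  rewrite sg; apply/negP => /eqP sg1; apply: nPg.
  by rewrite /lead_coef sg1 -(@size1_polyC _ g) ?sg1.
have Pt h : P h -> (map_poly ev h).[t] = 0.
  move=> Ph; have : map_poly ev (h %% g) = 0.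
    apply: ev_coefs => //; apply: gmin; last by rewrite ltn_modp.
    by rewrite modE; apply: idealB => //; apply: idealMl.
  rewrite modE rmorphB !rmorphM /= map_polyC /= => /(congr1 (fun p => p.[t])).
  rewrite hornerD hornerN !hornerM gt mulr0 subr0 hornerC horner0 => /eqP.
  by rewrite rmorphXn /= mulf_eq0 expf_eq0 (negPf evg) andbF => /eqP.
exists t => //; apply/eqP => ft; have := Pt _ Pcu.
rewrite Ec rmorphB rmorphM /= map_polyC hornerD hornerN hornerM hornerC ft mulr0.
by rewrite subr0 => /eqP; rewrite (negPf evc).
Qed.

End Specialization.

Section Nullstellensatz.

Variable k : closedFieldType.

Let theta n (h : {poly {mpoly k[n]}}) : {mpoly k[n.+1]} :=
  (map_poly (@mwiden n k) h).['X_ord_max].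

Lemma meval_mwiden n (v : 'I_n.+1 -> k) (p : {mpoly k[n]}) :
  (mwiden p).@[v] = p.@[fun i => v (widen_ord (leqnSn n) i)].
Proof.
elim/mpolyind: p => [|c m p _ _ IHp]; first by rewrite mwiden0 !meval0.
rewrite mwidenD !mevalD IHp; congr (_ + _).
rewrite mwidenZ !mevalZ mwidenX !mevalX; congr (_ * _).
rewrite big_ord_recr /= mnmwiden_ordmax expr0 mulr1.
by apply: eq_bigr => i _; rewrite mnmwiden_widen.
Qed.

Lemma mwiden_poly_surj n (f : {mpoly k[n.+1]}) : exists h, theta h = f.
Proof.
have thetaM : {morph @theta n : p q / p * q}.
  by move=> p q; rewrite /theta rmorphM hornerM.
have thetaD : {morph @theta n : p q / p + q}.
  by move=> p q; rewrite /theta rmorphD hornerD.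
have thetaC c : theta c%:MP%:P = c%:MP.
  by rewrite /theta map_polyC hornerC /= mwidenC.
elim/mpolyind: f => [|c m p _ _ [h <-]].
  by exists 0; rewrite /theta rmorph0 horner0.
suff [h' Eh'] : exists h', theta h' = 'X_[m].
  by exists (c%:MP%:P * h' + h); rewrite thetaD thetaM thetaC Eh' mul_mpolyC.
rewrite mpolyXE_id; elim/big_ind: _ => [|_ _ [h1 <-] [h2 <-]|i _].
- by exists 1; rewrite /theta rmorph1 hornerC.
- by exists (h1 * h2); rewrite thetaM.
suff [h' Eh'] : exists h', theta h' = 'X_i.
  exists (h' ^+ m i); elim: (m i) => [|e IHe]; last by rewrite !exprS thetaM IHe Eh'.
  by rewrite !expr0 /theta rmorph1 hornerC.
case: (unliftP ord_max i) => [j|] ->; last first.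
  by exists 'X; rewrite /theta map_polyX hornerX.
exists ('X_j)%:P; rewrite /theta map_polyC hornerC /= mwidenX mnmwiden1.
by congr 'X_[U_(_)]; apply/val_inj; exact/esym/lift_max.
Qed.

(** Induction on the number of variables: the b produced by specialization is what the inductive
    hypothesis has to avoid for the contracted prime. *)
Lemma nullstellensatz_prime n (P : {mpoly k[n]} -> Prop) f :
  is_prime_ideal P -> ~ P f ->
  exists2 v : 'I_n -> k, (forall g, P g -> g.@[v] = 0) & f.@[v] != 0.
Proof.
elim: n => [|n IHn] in P f *; move=> primeP nPf.
  have [idP nP1 _] := primeP.
  exists (fun=> 0) => [g Pg|].
    rewrite (nvar0_mpolyC g) mevalC; apply: contrapT => /eqP g0; apply: nP1.
    by rewrite -mpolyC1 -(mulVf g0) mpolyCM -nvar0_mpolyC; apply: idealMl.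
  rewrite (nvar0_mpolyC f) mevalC; apply/eqP => f0; apply: nPf.
  by rewrite (nvar0_mpolyC f) f0 mpolyC0; apply: ideal0.
have [idP nP1 prP] := primeP.
have thetaM p q : theta (p * q) = theta p * theta q :> {mpoly k[n.+1]}.
  by rewrite /theta rmorphM hornerM.
have thetaD p q : theta (p + q) = theta p + theta q :> {mpoly k[n.+1]}.
  by rewrite /theta rmorphD hornerD.
have thetaC c : theta c%:P = mwiden c :> {mpoly k[n.+1]}.
  by rewrite /theta map_polyC hornerC.
pose Q h := P (@theta n h).
have theta1 : theta 1 = 1 :> {mpoly k[n.+1]} by rewrite /theta rmorph1 hornerC.
have primeQ : is_prime_ideal Q by apply: prime_ideal_preim primeP.
have [f' Ef] := mwiden_poly_surj f.
have nQf : ~ Q f' by rewrite /Q Ef.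
have primeQ0 : is_prime_ideal (fun c : {mpoly k[n]} => Q c%:P).
  apply: prime_ideal_preim primeQ => // a b; [exact: polyCD|exact: polyCM].
have [b nQb evb] := prime_poly_specialization k primeQ nQf.
have [v vQ vb] := IHn _ _ primeQ0 nQb.
have [t tQ tf] := evb (meval v) vQ vb.
pose w (i : 'I_n.+1) := if unlift ord_max i is Some j then v j else t.
have thetaE h : (theta h).@[w] = (map_poly (meval v) h).[t].
  rewrite /theta -horner_map /= mevalXU /w unlift_none -map_poly_comp.
  congr (_.[_]); apply: eq_map_poly => c /=; rewrite meval_mwiden.
  apply: meval_eq => i; have -> : widen_ord (leqnSn n) i = lift ord_max i.
    by apply/val_inj; exact/esym/lift_max.
  by rewrite liftK.
exists w => [g Pg|]; last by rewrite -Ef thetaE.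
by have [g' Eg] := mwiden_poly_surj g; rewrite -Eg thetaE tQ // /Q Eg.
Qed.

End Nullstellensatz.

(** * Comparison of graded free resolutions *)

Section IntegerDegrees.

Variables (k : closedFieldType) (n : nat).
Notation S := {mpoly k[n]}.
Implicit Types (e : int) (f g : S).

(** The shifts [dg] are integers, so the degree of a matrix entry is a difference that may be
    negative; a negative degree leaves only 0. *)
Definition zhomog e f : Prop := forall m, m \in msupp f -> (mdeg m)%:Z = e.

Lemma zhomog0 e : zhomog e 0. Proof. by move=> m; rewrite msupp0. Qed.

Lemma zhomogD e f g : zhomog e f -> zhomog e g -> zhomog e (f + g).
Proof. by move=> ef eg m /msuppD_le; rewrite mem_cat => /orP[/ef|/eg]. Qed.

Lemma zhomogN e f : zhomog e f -> zhomog e (- f).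
Proof. by move=> ef m; rewrite (perm_mem (msuppN f)) => /ef. Qed.

Lemma zhomog_sum e (T : Type) (s : seq T) (F : T -> S) :
  (forall x, zhomog e (F x)) -> zhomog e (\sum_(x <- s) F x).
Proof.
by move=> eF; elim/big_ind: _ => // [|f g]; [exact: zhomog0|exact: zhomogD].
Qed.

Lemma zhomogM e e' f g : zhomog e f -> zhomog e' g -> zhomog (e + e') (f * g).
Proof.
move=> ef eg m /msuppM_le/allpairsP[[m1 m2] /= [/ef <- /eg <- ->]].
by rewrite mdegD PoszD.
Qed.

Lemma zhomogP (d : nat) f : reflect (zhomog d f) (f \is d.-homog).
Proof.
by apply: (iffP (dhomogP _ _ _)) => h m /h => [->|[]].
Qed.

Definition zpart e f : S := if e is Posz d then pihomog mdeg d f else 0.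

Lemma zpart0 e : zpart e 0 = 0.
Proof. by case: e => [d|d] //=; rewrite linear0. Qed.

Lemma zpartD e f g : zpart e (f + g) = zpart e f + zpart e g.
Proof. by case: e => [d|d] /=; rewrite ?linearD ?addr0. Qed.

Lemma zpart_sum e (T : Type) (s : seq T) (F : T -> S) :
  zpart e (\sum_(x <- s) F x) = \sum_(x <- s) zpart e (F x).
Proof. exact: (big_morph _ (zpartD e) (zpart0 e)). Qed.

Lemma zpart_zhomog e f : zhomog e (zpart e f).
Proof. by case: e => d /=; [apply/zhomogP/pihomogP|exact: zhomog0]. Qed.

Lemma zpart_id e f : zhomog e f -> zpart e f = f.
Proof.
case: e => d /=; first by move/zhomogP/pihomog_dE.
by rewrite [f in _ = f]mpolyE => ef; rewrite big_seq big1 // => m /ef.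
Qed.

Lemma zpart_neq e e' f : e != e' -> zhomog e f -> zpart e' f = 0.
Proof.
case: e' => d' //= ne; case: e ne => d ne; last first.
  by move/zpart_id <-; rewrite linear0.
by move/zhomogP; apply: pihomog_ne0.
Qed.

Lemma zpartM e e' f g :
  zhomog e g -> zpart (e' + e) (f * g) = zpart e' f * g.
Proof.
move=> eg; elim/mpolyind: f => [|c m p _ _ IHp].
  by rewrite mul0r !zpart0 mul0r.
rewrite mulrDl !zpartD mulrDl IHp; congr (_ + _).
have hm : zhomog (mdeg m) (c *: 'X_[m] : S).
  by apply/zhomogP; rewrite dhomogZ // dhomogX.
have [<-|ne] := eqVneq (mdeg m)%:Z e'.
  by rewrite !zpart_id //; apply: zhomogM.
rewrite (zpart_neq ne hm) mul0r; apply: zpart_neq (zhomogM hm eg).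
by apply: contra ne => /eqP/addIr ->.
Qed.

Lemma mcoeff_zpart e f m : (zpart e f)@_m = if e == (mdeg m)%:Z then f@_m else 0.
Proof.
elim/mpolyind: f => [|c m' p _ _ IHp]; first by rewrite zpart0 mcoeff0 if_same.
have hm : zhomog (mdeg m') (c *: 'X_[m'] : S).
  by apply/zhomogP; rewrite dhomogZ // dhomogX.
rewrite zpartD !mcoeffD IHp; have [<-|ne] := eqVneq (mdeg m')%:Z e.
  rewrite zpart_id //; case: eqP => // ne; rewrite mcoeffZ mcoeffX.
  by case: eqP ne => [->|_]; rewrite // mulr0 addr0.
rewrite (zpart_neq ne hm) mcoeff0 add0r; case: eqP => // em.
rewrite mcoeffZ mcoeffX; case: eqP => [mm|_]; last by rewrite mulr0 add0r.
by rewrite mm em eqxx in ne.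
Qed.

Definition graded_mx p q (dr : 'I_p -> int) (dc : 'I_q -> int)
    (M : 'M[S]_(p, q)) : Prop :=
  forall a b, zhomog (dr a - dc b) (M a b).

Definition mx_zpart p q (dr : 'I_p -> int) (dc : 'I_q -> int)
    (M : 'M[S]_(p, q)) :=
  \matrix_(a, b) zpart (dr a - dc b) (M a b).

Section GradedMatrices.

Variables (p q s : nat).
Variables (dp : 'I_p -> int) (dq : 'I_q -> int) (ds : 'I_s -> int).

Lemma graded_mxD M N : graded_mx dp dq M -> graded_mx dp dq N ->
  graded_mx dp dq (M + N).
Proof. by move=> gM gN a b; rewrite mxE; apply: zhomogD. Qed.

Lemma graded_mxN M : graded_mx dp dq M -> graded_mx dp dq (- M).
Proof. by move=> gM a b; rewrite mxE; apply: zhomogN. Qed.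

Lemma graded_mxB M N : graded_mx dp dq M -> graded_mx dp dq N ->
  graded_mx dp dq (M - N).
Proof. by move=> gM /graded_mxN; apply: graded_mxD. Qed.

Lemma graded_mx1 : graded_mx dp dp 1%:M.
Proof.
move=> a b m; rewrite mxE; case: eqVneq => [->|_]; last by rewrite msupp0.
by rewrite msupp1 inE subrr => /eqP ->; rewrite mdeg0.
Qed.

Lemma graded_mulmx M N : graded_mx dp dq M -> graded_mx dq ds N ->
  graded_mx dp ds (M *m N).
Proof.
move=> gM gN a b; rewrite mxE; apply: zhomog_sum => c.
by have := zhomogM (gM a c) (gN c b); rewrite addrA subrK.
Qed.

Lemma mx_zpart_graded M : graded_mx dp dq (mx_zpart dp dq M).
Proof. by move=> a b; rewrite mxE; apply: zpart_zhomog. Qed.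

Lemma mx_zpart_id M : graded_mx dp dq M -> mx_zpart dp dq M = M.
Proof. by move=> gM; apply/matrixP => a b; rewrite mxE zpart_id. Qed.

(** Exactness gives lifts that need not be homogeneous; since the differential is graded, the
    homogeneous part of a lift of a graded matrix is again a lift. *)
Lemma mx_zpartM M N : graded_mx dq ds N ->
  mx_zpart dp ds (M *m N) = mx_zpart dp dq M *m N.
Proof.
move=> gN; apply/matrixP => a b; rewrite !mxE zpart_sum; apply: eq_bigr => c _.
by rewrite mxE -(zpartM _ _ (gN c b)) addrA subrK.
Qed.

End GradedMatrices.

End IntegerDegrees.

Section Resolutions.

Variables (k : closedFieldType) (r : nat).
Notation S := {mpoly k[r.+1]}.
Notation cst := (mcoeff 0%MM).

Definition aug_mx (F : free_resolution k r) m (M : 'M[S]_(m, rk F 0)) :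
    'M[k]_(m, 1) :=
  map_mx cst M *m aug F.
Arguments aug_mx F [m] M.

Lemma factor_rows p q s (D : 'M[S]_(q, s)) (M : 'M[S]_(p, s)) :
  (forall a, exists w, row a M = w *m D) -> exists N, M = N *m D.
Proof.
move=> /choice[f fP]; exists (\matrix_a f a); apply/row_matrixP => a.
by rewrite row_mul rowK.
Qed.

Section OneResolution.

Variable F : free_resolution k r.
Notation d := (differential F).

Lemma aug_mxM p q (M : 'M[S]_(p, q)) N :
  aug_mx F (M *m N) = map_mx cst M *m aug_mx F N.
Proof. by rewrite /aug_mx map_mxM mulmxA. Qed.

Lemma differential_graded i : graded_mx (@dg _ _ F i.+1) (@dg _ _ F i) (d i).
Proof. by move=> a b m /differential_homog <-; rewrite addrK. Qed.

Lemma aug_differential : aug_mx F (d 0) = 0.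
Proof.
apply/row_matrixP => a; rewrite row0 row_mul -map_row.
by apply/exact_aug; exists (delta_mx 0 a); rewrite -rowE.
Qed.

Lemma differential_sq i : d i.+1 *m d i = 0.
Proof.
apply/row_matrixP => a; rewrite row0 row_mul.
by apply/exact_differential; exists (delta_mx 0 a); rewrite -rowE.
Qed.

Section GradedRows.

Variables (p : nat) (dp : 'I_p -> int).

Lemma lift_aug (M : 'M[S]_(p, rk F 0)) :
  graded_mx dp (@dg _ _ F 0) M -> aug_mx F M = 0 ->
  exists2 N, graded_mx dp (@dg _ _ F 1) N & M = N *m d 0.
Proof.
move=> gM M0; have [a|N EN] := @factor_rows _ _ _ (d 0) M.
  by apply/exact_aug; rewrite map_row -row_mul -/(aug_mx F M) M0 row0.
exists (mx_zpart dp (@dg _ _ F 1) N); first exact: mx_zpart_graded.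
by rewrite -(mx_zpartM dp N (@differential_graded 0)) -EN mx_zpart_id.
Qed.

Lemma lift_differential i (M : 'M[S]_(p, rk F i.+1)) :
  graded_mx dp (@dg _ _ F i.+1) M -> M *m d i = 0 ->
  exists2 N, graded_mx dp (@dg _ _ F i.+2) N & M = N *m d i.+1.
Proof.
move=> gM M0; have [a|N EN] := @factor_rows _ _ _ (d i.+1) M.
  by apply/exact_differential; rewrite -row_mul M0 row0.
exists (mx_zpart dp (@dg _ _ F i.+2) N); first exact: mx_zpart_graded.
by rewrite -(mx_zpartM dp N (@differential_graded i.+1)) -EN mx_zpart_id.
Qed.

End GradedRows.

End OneResolution.

Section ChainMaps.

Variables F G : free_resolution k r.
Notation dF := (differential F).
Notation dG := (differential G).

Definition graded_map i (M : 'M[S]_(rk F i, rk G i)) :=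
  graded_mx (@dg _ _ F i) (@dg _ _ G i) M.

Lemma lift_identity : exists2 M, @graded_map 0 M & aug_mx G M = aug F.
Proof.
have [v v1] := aug_surj G.
pose N := map_mx (@mpolyC r.+1 k) (aug F) *m v.
exists (mx_zpart (@dg _ _ F 0) (@dg _ _ G 0) N); first exact: mx_zpart_graded.
have <- : aug_mx G N = aug F.
  rewrite aug_mxM /aug_mx v1 mulmx1; apply/matrixP => a b.
  by rewrite !mxE mcoeffC eqxx mulr1.
apply/matrixP => a b; rewrite !mxE; apply: eq_bigr => c _.
have mapE X : map_mx cst X a c = (X a c)@_0%MM by rewrite mxE.
rewrite {b}[b]ord1 !mapE mxE mcoeff_zpart mdeg0.
(* A nonzero augmentation forces degree 0, so projecting to the graded part keeps every constant
   term that the augmentation sees. *)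
have [->|/aug_homog ->] := eqVneq (aug G c 0) 0; first by rewrite !mulr0.
rewrite subr0; case: eqP => // /eqP da; congr (_ * _).
have Na : aug F a 0 = 0.
  by apply: contraNeq da => /aug_homog ->.
by rewrite [N a c]mxE big_ord1 mxE Na mpolyC0 mul0r mcoeff0.
Qed.

Lemma lift_chain_map i (f0 : 'M_(rk F i, rk G i))
    (f1 : 'M_(rk F i.+1, rk G i.+1)) :
    graded_map f1 -> dF i *m f0 = f1 *m dG i ->
  exists2 f2, @graded_map i.+2 f2 & dF i.+1 *m f1 = f2 *m dG i.+1.
Proof.
move=> gf1 comm; apply: lift_differential.
  by apply: graded_mulmx gf1; apply: differential_graded.
by rewrite -mulmxA -comm mulmxA differential_sq mul0mx.
Qed.

Lemma lift_chain_map0 (f0 : 'M_(rk F 0, rk G 0)) :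
    graded_map f0 -> aug_mx G f0 = aug F ->
  exists2 f1, @graded_map 1 f1 & dF 0 *m f0 = f1 *m dG 0.
Proof.
move=> gf0 f0aug; apply: lift_aug.
  by apply: graded_mulmx gf0; apply: differential_graded.
by rewrite aug_mxM f0aug -/(aug_mx F _) aug_differential.
Qed.


End ChainMaps.

Section Comparison.

Variables F G : free_resolution k r.
Notation dF := (differential F).
Notation dG := (differential G).

(** Two consecutive levels, as lifting a chain map needs the preceding square. The homotopy identity
    stays outside because it has one term at level 0 and two above. *)
Record comparison i (f0 : 'M_(rk F i, rk G i)) (f1 : 'M_(rk F i.+1, rk G i.+1))
    (g0 : 'M_(rk G i, rk F i)) (g1 : 'M_(rk G i.+1, rk F i.+1))
    (h0 : 'M[S]_(rk F i, rk F i.+1)) : Prop := Comparison {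
  cmp_f0 : graded_map f0; cmp_f1 : graded_map f1;
  cmp_g0 : graded_map g0; cmp_g1 : graded_map g1;
  cmp_h0 : @graded_mx k r.+1 _ _ (@dg _ _ F i) (@dg _ _ F i.+1) h0;
  cmp_f : dF i *m f0 = f1 *m dG i;
  cmp_g : dG i *m g0 = g1 *m dF i }.

Lemma comparison0 : exists f0 f1 g0 g1 h0,
  @comparison 0 f0 f1 g0 g1 h0 /\ 1%:M - f0 *m g0 = h0 *m dF 0.
Proof.
have [f0 gf0 f0aug] := lift_identity F G.
have [g0 gg0 g0aug] := lift_identity G F.
have [f1 gf1 cf] := lift_chain_map0 gf0 f0aug.
have [g1 gg1 cg] := lift_chain_map0 gg0 g0aug.
have gM : graded_mx (@dg _ _ F 0) (@dg _ _ F 0) (1%:M - f0 *m g0).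
  by apply: graded_mxB; [apply: graded_mx1|apply: graded_mulmx gg0].
have [|h0 gh0 Eh0] := lift_aug gM.
  rewrite /aug_mx map_mxB mulmxBl map_mx1 mul1mx -/(aug_mx F _) aug_mxM g0aug.
  by rewrite -/(aug_mx G _) f0aug subrr.
by exists f0, f1, g0, g1, h0; split.
Qed.

Lemma comparisonS i : exists f0 f1 f2 g0 g1 g2 h0 h1,
  [/\ @comparison i f0 f1 g0 g1 h0, @comparison i.+1 f1 f2 g1 g2 h1 &
      1%:M - f1 *m g1 = h1 *m dF i.+1 + dF i *m h0].
Proof.
(* The homotopy identity is assumed after multiplication by [dF j]: this form is common to level 0
   and to higher levels, where the second term dies by d^2 = 0. *)
have step j f0 f1 g0 g1 h0 : @comparison j f0 f1 g0 g1 h0 ->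
    dF j *m (1%:M - f0 *m g0) = dF j *m h0 *m dF j ->
  exists f2 g2 h1, @comparison j.+1 f1 f2 g1 g2 h1 /\
    1%:M - f1 *m g1 = h1 *m dF j.+1 + dF j *m h0.
  case=> gf0 gf1 gg0 gg1 gh0 cf cg hE.
  have [f2 gf2 cf1] := lift_chain_map gf1 cf.
  have [g2 gg2 cg1] := lift_chain_map gg1 cg.
  have gM : graded_mx (@dg _ _ F j.+1) (@dg _ _ F j.+1)
      (1%:M - f1 *m g1 - dF j *m h0).
    apply: graded_mxB; last first.
      by apply: graded_mulmx gh0; apply: differential_graded.
    by apply: graded_mxB; [apply: graded_mx1|apply: graded_mulmx gg1].
  have [|h1 gh1 Eh1] := lift_differential gM.
    rewrite !mulmxBl mul1mx -mulmxA -cg mulmxA -cf -hE -mulmxA mulmxBr mulmx1.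
    by rewrite subrr.
  by exists f2, g2, h1; split=> //; rewrite -Eh1 subrK.
elim: i => [|i [f0 [f1 [f2 [g0 [g1 [g2 [h0 [h1 [_ C1 E1]]]]]]]]]].
  have [f0 [f1 [g0 [g1 [h0 [C0 E0]]]]]] := comparison0.
  have [|f2 [g2 [h1 [C1 E1]]]] := step _ _ _ _ _ _ C0.
    by rewrite E0 mulmxA.
  by exists f0, f1, f2, g0, g1, g2, h0, h1; split.
have [|f3 [g3 [h2 [C2 E2]]]] := step _ _ _ _ _ _ C1.
  by rewrite E1 mulmxDr !mulmxA differential_sq mul0mx addr0.
by exists f1, f2, f3, g1, g2, g3, h1, h2; split.
Qed.

Lemma tor_chain_mulmx J p q n (v : 'rV_(rk F p)) (M : 'M_(rk F p, rk G q)) :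
    is_ideal J -> graded_mx (@dg _ _ F p) (@dg _ _ G q) M ->
  tor_chain J n v -> tor_chain J n (v *m M).
Proof.
move=> idJ gM vn b; split.
  by rewrite mxE; apply: ideal_sum => // a _; apply: idealMr => //; case: (vn a).
have gv : graded_mx (fun=> n) (@dg _ _ F p) v.
  move=> a b' m; have [_ nb] := vn b'; rewrite [a]ord1 => /nb <-.
  by rewrite addrK.
by move=> m /(graded_mulmx gv gM) ->; rewrite subrK.
Qed.

End Comparison.

(* A chain homotopy equivalence between the resolutions acts on J (x) F and
   J' (x) F compatibly, as it is given by matrices over S. *)
Lemma tor_map_surjective_indep (F G : free_resolution k r) J J' p n :
    is_ideal J -> is_ideal J' ->
  tor_map_surjective G J J' p n -> tor_map_surjective F J J' p n.
Proof.
move=> idJ idJ' surj v [vJ' vcyc].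
have [f0 [g0 [g1 [h0 [[gf0 gg0 gg1 gh0] [cg fcyc gcyc hE]]]]]] :
  exists f0 g0 g1 h0,
    [/\ @graded_map F G p f0, @graded_map G F p g0, @graded_map G F p.+1 g1
     & graded_mx (@dg _ _ F p) (@dg _ _ F p.+1) h0] /\
    [/\ differential G p *m g0 = g1 *m differential F p,
        is_cycle (v *m f0),
        forall u : 'rV_(rk G p), is_cycle u -> is_cycle (u *m g0)
      & v - v *m f0 *m g0 = v *m h0 *m differential F p].
  case: p => [|p] in v vJ' vcyc surj *.
    have [f0 [f1 [g0 [g1 [h0 [[? ? ? ? ? ? ?] E0]]]]]] := comparison0 F G.
    exists f0, g0, g1, h0; split; split=> //.
    by rewrite -[RHS]mulmxA -E0 mulmxBr mulmx1 mulmxA.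
  have [f0 [f1 [f2 [g0 [g1 [g2 [h0 [h1 [C0 C1 E1]]]]]]]]] := comparisonS F G p.
  case: C0 C1 => ? ? ? ? ? cf cg [? ? ? ? ? ? ?].
  exists f1, g1, g2, h1; split; split=> //=.
  - by rewrite -mulmxA -cf mulmxA vcyc mul0mx.
  - by move=> u /= ucyc; rewrite -mulmxA -cg mulmxA ucyc mul0mx.
  rewrite -[v in v - _]mulmx1 -!mulmxA -mulmxBr E1 mulmxDr !mulmxA vcyc.
  by rewrite mul0mx addr0.
have [|u [uJ ucyc] [w wJ' Ew]] := surj (v *m f0).
  by split=> //; apply: tor_chain_mulmx vJ'.
exists (u *m g0); first by split; [apply: tor_chain_mulmx uJ|apply: gcyc].
(* [v - u *m g0] splits as (v - v f0 g0) + (v f0 - u) g0; the homotopy bounds the first summand and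
   [w *m g1] the second. *)
exists (v *m h0 + w *m g1).
  move=> a; have [J1 n1] := tor_chain_mulmx idJ' gh0 vJ' a.
  have [J2 n2] := tor_chain_mulmx idJ' gg1 wJ' a.
  rewrite mxE; split; first exact: idealD.
  by move=> m /msuppD_le; rewrite mem_cat => /orP[/n1|/n2].
rewrite mulmxDl -hE -[in RHS](mulmxA w) -cg mulmxA -Ew mulmxBl.
by rewrite addrA subrK.
Qed.

End Resolutions.

(** * The Koszul complex as an iterated mapping cone *)

Section Cones.

Variable A : comNzRingType.

Record free_complex := FreeComplex {
  crk : nat -> nat;
  cdiff : forall i, 'M[A]_(crk i.+1, crk i) }.

Implicit Types (K : free_complex) (x : A).

Definition exact_complex K : Prop := forall i (v : 'rV_(crk K i.+1)),
  v *m cdiff K i = 0 <-> exists w, v = w *m cdiff K i.+1.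

Definition cone_rk K i : nat :=
  if i is i'.+1 then (crk K i'.+1 + crk K i')%N else crk K 0.

(** Mapping cone of multiplication by x, acting on rows (u, w) with u in K_{i+1} and w in K_i. The
    sign cancels the two contributions of x to the square of the differential. *)
Definition cone_diff K x i : 'M[A]_(cone_rk K i.+1, cone_rk K i) :=
  match i with
  | 0 => col_mx (cdiff K 0) x%:M
  | i'.+1 => block_mx (cdiff K i'.+1) 0 x%:M (- cdiff K i')
  end.

Definition cone K x := FreeComplex (cone_diff K x).

Lemma cone_sq_col m2 m1 m0 (D1 : 'M[A]_(m2, m1)) (D0 : 'M[A]_(m1, m0)) x :
  D1 *m D0 = 0 -> block_mx D1 0 x%:M (- D0) *m col_mx D0 x%:M = 0.
Proof.
move=> sq; rewrite mul_block_col sq mul0mx addr0 mul_scalar_mx mulNmx.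
by rewrite mul_mx_scalar subrr col_mx0.
Qed.

Lemma cone_sq_block m3 m2 m1 m0 (D2 : 'M[A]_(m3, m2)) (D1 : 'M[A]_(m2, m1))
    (D0 : 'M[A]_(m1, m0)) x :
  D2 *m D1 = 0 -> D1 *m D0 = 0 ->
  block_mx D2 0 x%:M (- D1) *m block_mx D1 0 x%:M (- D0) = 0.
Proof.
move=> sq1 sq0; rewrite mulmx_block sq1 !mul0mx mulmx0 !mulNmx mulmxN sq0 !oppr0.
rewrite mul_mx_scalar mul_scalar_mx subrr mulmx0 !add0r; exact: block_mx_const.
Qed.

(** The second hypothesis says that x is a nonzerodivisor on the cokernel of [cdiff K 0]. It serves
    in the lowest degree, where the cycle condition only says that x w is a boundary. *)
Lemma exact_complex_cone K x : exact_complex K ->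
    (forall w : 'rV[A]_(crk K 0), (exists u, x *: w = u *m cdiff K 0) ->
      exists u, w = u *m cdiff K 0) ->
  exact_complex (cone K x).
Proof.
move=> exK regx.
have sq i : cdiff K i.+1 *m cdiff K i = 0.
  apply/row_matrixP => a; rewrite row0 row_mul.
  by apply/exK; exists (delta_mx 0 a); rewrite -rowE.
move=> i v; change ('rV[A]_(crk K i.+1 + crk K i)) in v; split; last first.
  case=> w ->; rewrite -mulmxA -[RHS](mulmx0 _ w); congr (w *m _).
  case: i {v w} => [|i]; first exact: cone_sq_col (sq 0%N).
  exact: cone_sq_block (sq i.+1) (sq i).
rewrite -[v]hsubmxK; move: (lsubmx v) (rsubmx v) => {v} u w vd.
have [w' Ew] : exists w', w = w' *m cdiff K i.
  case: i u w vd => [|i] u w /=.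
    rewrite mul_row_col => /eqP; rewrite addr_eq0 => /eqP Eu.
    apply: regx; exists (- u); rewrite mulNmx Eu opprK -mul_mx_scalar //.
  rewrite mul_row_block mulmxN => /eqP; rewrite row_mx_eq0 mulmx0 add0r oppr_eq0.
  by case/andP=> _ /eqP/exK.
(* Once w is the boundary of w', the first component needs the correction x w' to become a cycle of
   K. *)
have [u' Eu] : exists u', u + x *: w' = u' *m cdiff K i.+1.
  apply/exK; rewrite mulmxDl -scalemxAl -Ew.
  case: i u w w' vd Ew => [|i] u w w' /=.
    by rewrite mul_row_col mul_mx_scalar.
  rewrite mul_row_block mul_mx_scalar => /eqP; rewrite row_mx_eq0.
  by case/andP=> /eqP.
exists (row_mx u' (- w')); rewrite /= mul_row_block mul_mx_scalar mulmx0 add0r.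
by rewrite -Eu mulNmx mulmxN opprK -Ew scalerN addrK.
Qed.

End Cones.

Section Koszul.

Variables (k : closedFieldType) (r : nat).
Notation S := {mpoly k[r.+1]}.

Definition trivial_complex : free_complex S :=
  @FreeComplex S (fun i => if i is 0 then 1%N else 0%N) (fun=> 0).

Fixpoint koszul n : free_complex S :=
  if n is n'.+1 then cone (koszul n') 'X_(inord n') else trivial_complex.

(** The ideal of the first n variables, read off monomials so that regularity of the next variable
    is a matter of supports. *)
Definition vars_ideal n (f : S) : Prop :=
  forall m, m \in msupp f -> exists2 j : 'I_r.+1, (j < n)%N & m j != 0%N.

Lemma vars_ideal_is_ideal n : is_ideal (vars_ideal n).
Proof.
split=> [m|f g If Ig m|f g Ig m]; first by rewrite msupp0.
  by move/msuppD_le; rewrite mem_cat => /orP[/If|/Ig].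
move/msuppM_le/allpairsP=> [[m1 m2] /= [_ /Ig[j jn mj] ->]].
by exists j => //; rewrite mnmDE addn_eq0 negb_and mj orbT.
Qed.

Lemma vars_idealX n (m : 'X_{1..r.+1}) (j : 'I_r.+1) :
  (j < n)%N -> m j != 0%N -> vars_ideal n 'X_[m].
Proof. by move=> jn mj m'; rewrite msuppX inE => /eqP ->; exists j. Qed.

Lemma vars_ideal_regular n f : (n < r.+1)%N ->
  vars_ideal n ('X_(inord n) * f) -> vars_ideal n f.
Proof.
move=> nr If m mf; have : (m + U_(inord n))%MM \in msupp ('X_(inord n) * f).
  by rewrite mcoeff_msupp mulrC addmC mcoeffMX -mcoeff_msupp.
move=> /If[j jn]; rewrite mnmDE mnm1E addn_eq0 negb_and.
case: (eqVneq (inord n) j) => [E|_].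
  by move: jn; rewrite -E inordK // ltnn.
by rewrite orbF; exists j.
Qed.

Lemma vars_idealS n f : (n < r.+1)%N -> vars_ideal n.+1 f ->
  exists f0 f1, vars_ideal n f0 /\ f = f0 + 'X_(inord n) * f1.
Proof.
move=> nr If; pose i : 'I_r.+1 := inord n.
exists (\sum_(m <- msupp f | m i == 0%N) f@_m *: 'X_[m]).
exists (\sum_(m <- msupp f | m i != 0%N) f@_m *: 'X_[m - U_(i)]); split.
  have idn := vars_ideal_is_ideal n; apply: (ideal_sum_seq idn) => m mf mi.
  rewrite -mul_mpolyC; apply: (idealMl idn).
  have [j jn mj] := If _ mf; apply: (@vars_idealX _ _ j) => //.
  move: jn; rewrite ltnS leq_eqVlt => /orP[/eqP jn|//].
  by rewrite -(inord_val j) jn (eqP mi) in mj.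
rewrite [LHS]mpolyE (bigID (fun m : 'X_{1..r.+1} => m i == 0%N)) /=; congr (_ + _).
rewrite mulr_sumr; apply: eq_bigr => m mi.
by rewrite -scalerAr -mpolyXD addmC submK // lep1mP.
Qed.

(** Both claims go through one induction: knowing the image of the first differential is what makes
    the next variable regular on the cokernel. *)
Lemma koszul_exact n : (n <= r.+1)%N ->
  exact_complex (koszul n) /\ forall w : 'rV[S]_(crk (koszul n) 0),
    (forall b, vars_ideal n (w 0 b)) <->
     exists u, w = u *m cdiff (koszul n) 0.
Proof.
elim: n => [_|n IHn nr] /=.
  split=> [i v|w].
    have -> : v = 0 by apply/matrixP => a [].
    by rewrite mul0mx; split=> // _; exists 0; rewrite mul0mx.
  split=> [w0|[u ->] b]; last first.
    by rewrite mulmx0 mxE; apply: (ideal0 (vars_ideal_is_ideal 0)).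
  exists 0; rewrite mul0mx; apply/rowP => b; rewrite mxE; apply/eqP.
  rewrite -msupp_eq0; case E: (msupp _) => [//|m s].
  by have [|] := w0 b m; rewrite ?E ?mem_head.
have [exn imn] := IHn (ltnW nr); have idn m := vars_ideal_is_ideal m; split.
  apply: exact_complex_cone exn _ => w [u Eu].
  apply/imn => b; apply: vars_ideal_regular => //.
  have /imn/(_ b) : exists u, 'X_(inord n) *: w = u *m cdiff (koszul n) 0.
    by exists u.
  by rewrite mxE.
move=> w; split=> [Iw|[u ->] b].
  have /choice[f0] b := vars_idealS nr (Iw b).
  move=> /choice[f1 f01].
  have [|u Eu] := (imn (\row_b f0 b)).1.
    by move=> b; rewrite mxE; case: (f01 b).
  exists (row_mx u (\row_b f1 b)); rewrite mul_row_col -Eu mul_mx_scalar.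
  by apply/rowP => b; rewrite !mxE; case: (f01 b).
rewrite -[u]hsubmxK mul_row_col mul_mx_scalar mxE; apply: (idealD (idn _)).
  have /imn/(_ b) Iu : exists u',
      lsubmx u *m cdiff (koszul n) 0 = u' *m cdiff (koszul n) 0.
    by eexists.
  by move=> m /Iu[j jn mj]; exists j => //; apply: ltnW.
rewrite mxE; apply: (idealMr (idn _)); apply: (@vars_idealX _ _ (inord n)).
  by rewrite inordK.
by rewrite mnm1E eqxx.
Qed.

Lemma koszul_linear n i a b : zhomog 1 (cdiff (koszul n) i a b).
Proof.
elim: n => [|n IHn] in i a b *; first by rewrite mxE; apply: zhomog0.
have hX m (c d : 'I_m) : zhomog 1 (('X_(inord n))%:M c d : S).
  rewrite mxE; case: eqP => _; last exact: zhomog0.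
  by apply/(zhomogP 1); rewrite mulr1n dhomogX; apply/eqP/mdeg1.
case: i a b => [|i] /= a b; rewrite -(splitK a).
  by case: (split a) => c; rewrite ?col_mxEu ?col_mxEd.
rewrite -(splitK b); case: (split a) => c; case: (split b) => e.
- by rewrite block_mxEul.
- by rewrite block_mxEur mxE; apply: zhomog0.
- by rewrite block_mxEdl.
by rewrite block_mxEdr mxE; apply: zhomogN.
Qed.

Lemma koszul_rk0 n : crk (koszul n) 0 = 1%N.
Proof. by elim: n. Qed.

Lemma mulmx_ones (R : comNzRingType) n (v : 'rV[R]_n) :
  n = 1%N -> v *m (const_mx 1 : 'cV_n) = 0 <-> v = 0.
Proof.
move=> n1; rewrite {n}n1 in v *; split=> [|->]; last by rewrite mul0mx.
move/rowP/(_ 0); rewrite !mxE big_ord1 mxE mulr1 => v0.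
by apply/rowP => b; rewrite [b]ord1 mxE.
Qed.

Lemma vars_ideal_max f : vars_ideal r.+1 f <-> f@_0%MM = 0.
Proof.
split=> [If|f0 m mf].
  by apply/eqP; rewrite mcoeff_eq0; apply/negP => /If[j _]; rewrite mnm0E.
have [/forallP m0|/existsP] := boolP [forall j, m j == 0%N].
  have m00 : m = 0%MM by apply/mnmP => j; rewrite mnm0E; apply/eqP.
  by move: mf; rewrite mcoeff_msupp m00 f0 eqxx.
by case=> j mj; exists j.
Qed.

Lemma linear_resolution :
  exists F : free_resolution k r, forall i a, @dg _ _ F i a = i%:Z.
Proof.
pose K := koszul r.+1; have [exK imK] := koszul_exact (leqnn r.+1).
have K1 := koszul_rk0 r.+1.
have homK i a b m : m \in msupp (cdiff K i a b) -> (mdeg m)%:Z + i%:Z = i.+1%:Z.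
  by move/koszul_linear ->.
have surjK : exists v : 'rV[S]_(crk K 0),
    map_mx (mcoeff 0%MM) v *m (const_mx 1 : 'cV[k]_(crk K 0)) = 1%:M.
  exists (const_mx 1); move: (crk K 0) K1 => _ ->.
  by apply/matrixP => a b; rewrite !ord1 !mxE big_ord1 !mxE mcoeff1 eqxx mulr1.
have augK (v : 'rV[S]_(crk K 0)) :
    map_mx (mcoeff 0%MM) v *m (const_mx 1 : 'cV[k]_(crk K 0)) = 0 <->
    exists w, v = w *m cdiff K 0.
  rewrite -imK mulmx_ones //; split=> [v0 b|v0].
    by apply/vars_ideal_max; move/rowP/(_ b): v0; rewrite !mxE.
  by apply/rowP => b; rewrite !mxE; apply/vars_ideal_max.
by exists (@FreeResolution k r (crk K) (fun i _ => i%:Z) (cdiff K) (const_mx 1)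
  homK (fun _ _ => erefl) surjK augK exK).
Qed.

End Koszul.

(** * Green's vanishing argument *)

Section LinearSyzygies.

Variables (k : closedFieldType) (r : nat) (G : free_resolution k r).
Notation S := {mpoly k[r.+1]}.
Notation point := ('I_r.+1 -> k).
Hypothesis linG : forall i a, @dg _ _ G i a = i%:Z.

Let D i (x : point) : 'M[k]_(rk G i.+1, rk G i) :=
  map_mx (meval x) (differential G i).

Lemma zhomog1_meval (l : S) (x y : point) : zhomog 1 l ->
  l.@[fun i => x i + y i] = l.@[x] + l.@[y].
Proof.
move=> l1; rewrite !mevalE -big_split /= big_seq [RHS]big_seq.
apply: eq_bigr => m /l1[/eqP]; rewrite mdeg_eq1 => /existsP[i /eqP ->].
rewrite -mulrDr; congr (_ * _).
have prodU (z : point) : \prod_j z j ^+ U_(i)%MM j = z i.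
  by rewrite -[LHS](mevalX z) mevalXU.
by rewrite !prodU.
Qed.

Let diff1 i a b : zhomog 1 (differential G i a b).
Proof.
by have := @differential_graded _ _ G i a b; rewrite !linG intS addrK.
Qed.

(** Polarization of d^2 = 0 at x + y, where D is additive because its entries are linear forms. *)
Lemma linear_differential_anticomm i x y :
  D i.+1 x *m D i y = - (D i.+1 y *m D i x).
Proof.
have Dsq z : D i.+1 z *m D i z = 0 by rewrite -map_mxM differential_sq map_mx0.
have DD j : D j (fun i => x i + y i) = D j x + D j y.
  by apply/matrixP => a b; rewrite !mxE zhomog1_meval.
have := Dsq (fun i => x i + y i).
rewrite !DD mulmxDl !mulmxDr !Dsq add0r addr0 => /eqP.
by rewrite addr_eq0 => /eqP.
Qed.

(** By exactness the constant row T is w d, and d has no constant terms. *)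
Lemma linear_differential_inj p (T : 'rV[k]_(rk G p.+1)) :
  map_mx (@mpolyC r.+1 k) T *m differential G p = 0 -> T = 0.
Proof.
move/exact_differential => [w /(congr1 (map_mx (mcoeff 0%MM)))].
rewrite map_mxM; have -> : map_mx (mcoeff 0%MM) (differential G p.+1) = 0.
  apply/matrixP => a b; rewrite !mxE; apply/eqP; rewrite mcoeff_eq0.
  by apply/negP => /diff1; rewrite mdeg0.
rewrite mulmx0 => T0; apply/rowP => a; move/rowP/(_ a): T0.
by rewrite !mxE mcoeffC eqxx mulr1.
Qed.

Variable Z : point -> Prop.

Definition vanishes (f : S) : Prop := forall x, Z x -> f.@[x] = 0.

Hypothesis irrZ : forall f g, vanishes (f * g) -> vanishes f \/ vanishes g.
Hypothesis spanZ : forall l, l \is 1.-homog -> vanishes l -> l = 0.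

Definition syzygy_at w p (q : 'I_w -> S) (tau : 'I_w -> 'rV[k]_(rk G p))
    (x : point) : Prop :=
  match p return ('I_w -> 'rV[k]_(rk G p)) -> Prop with
  | 0 => fun=> True
  | p'.+1 => fun tau => (\sum_i (q i).@[x] *: tau i) *m D p' x = 0
  end tau.

(* Green's vanishing argument: contracting with a general point x of Z turns
   sum_i tau_i q_i into an element with coefficients in the subspace of the
   q's that vanish at x, which lowers both p and w. *)
Lemma linear_syzygy_vanishing w p (q : 'I_w -> S)
    (tau : 'I_w -> 'rV[k]_(rk G p)) :
    (w <= p)%N -> (forall x, Z x -> syzygy_at q tau x) ->
  forall y, Z y -> \sum_i (q i).@[y] *: tau i = 0.
Proof.
elim: p => [|p IHp] in w q tau *.
  by rewrite leqn0 => /eqP w0 _ y _; subst w; rewrite big_ord0.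
move=> wp syz y Zy; have [q0|/existsNP[i0 nq0]] := EM (forall i, vanishes (q i)).
  by rewrite big1 // => i _; rewrite q0 ?scale0r.
case: w => [|w] in q tau wp syz i0 nq0 *; first by case: i0 nq0.
have contract x : Z x -> (q i0).@[x] != 0 ->
    (\sum_i (q i).@[y] *: tau i) *m D p x = 0.
  move=> Zx qx.
  (* Chosen so that every [q' j] vanishes at x, with one quadric fewer. *)
  pose c (j : 'I_w) := (q (lift i0 j)).@[x] / (q i0).@[x].
  pose q' (j : 'I_w) : S := q (lift i0 j) - c j *: q i0.
  pose tau' (j : 'I_w) : 'rV_(rk G p) := tau (lift i0 j) *m D p x.
  have E z : \sum_j (q' j).@[z] *: tau' j =
      (\sum_i (q i).@[z] *: tau i) *m D p x.
    rewrite mulmx_suml.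
    have := syz _ Zx; rewrite /= mulmx_suml => syzx.
    (* What is subtracted is a multiple of the syzygy at x, hence 0; it cancels the term of [i0]. *)
    transitivity (\sum_i
        ((q i).@[z] - (q i).@[x] / (q i0).@[x] * (q i0).@[z]) *:
        (tau i *m D p x)).
      rewrite (bigD1_ord i0) //= divff // mul1r subrr scale0r add0r.
      by apply: eq_bigr => j _; rewrite mevalB mevalZ.
    under [LHS]eq_bigr do rewrite scalerBl; rewrite sumrB.
    under [X in _ - X]eq_bigr do rewrite mulrAC -mulrA mulrC -scalerA scalemxAl.
    rewrite -scaler_sumr syzx scaler0 subr0.
    by apply: eq_bigr => i _; rewrite scalemxAl.
  rewrite -E; apply: IHp => // z Zz; rewrite /syzygy_at.
  case: p tau syz wp tau' E => //= p tau syz _ tau' ->.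
  rewrite -mulmxA linear_differential_anticomm mulmxN mulmxA.
  by have /= -> := syz _ Zz; rewrite mul0mx oppr0.
(* T is constant, so each entry l of T d is a linear form. By [contract], l * q i0 vanishes on Z;
   irreducibility and spanning then give l = 0. *)
set T := \sum_i _ in contract *; apply: linear_differential_inj.
apply/rowP => b; rewrite [RHS]mxE; set l := _ 0 b.
have lE x : l.@[x] = (T *m D p x) 0 b.
  rewrite /l !mxE raddf_sum /=; apply: eq_bigr => a _.
  by rewrite mevalM !mxE mevalC.
apply: spanZ.
  apply/(zhomogP 1); rewrite /l mxE; apply: zhomog_sum => a.
  apply: (zhomogM (e := 0) (e' := 1)) => //; rewrite mxE.
  by apply/(zhomogP 0); rewrite -[_%:MP]mulr1 mul_mpolyC dhomogZ ?dhomog1.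
have [|//|/nq0//] := @irrZ l (q i0).
move=> x Zx; rewrite mevalM lE; have [->|qx] := eqVneq (q i0).@[x] 0.
  by rewrite mulr0.
by rewrite contract // mxE mul0r.
Qed.

End LinearSyzygies.

(** * Minimal homogeneous primes and irreducible components *)

Section HomogeneousPrimes.

Variables (k : closedFieldType) (r : nat).
Notation S := {mpoly k[r.+1]}.
Notation part := (pihomog mdeg).

Lemma pihomogM N D (f g : S) : (msize f <= N)%N -> (msize g <= N)%N ->
  part D (f * g) =
  \sum_(i < N) \sum_(j < N | (i + j)%N == D) part i f * part j g.
Proof.
move=> fN gN; rewrite {1}(@pihomog_partitionE _ _ mdeg N f) //.
rewrite {1}(@pihomog_partitionE _ _ mdeg N g) // mulr_suml linear_sum.
apply: eq_bigr => i _; rewrite mulr_sumr linear_sum [RHS]big_mkcond /=.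
apply: eq_bigr => j _.
have hij := dhomogM (pihomogP mdeg i f) (pihomogP mdeg j g).
by case: eqP => [<-|/eqP ne]; [rewrite pihomog_dE|rewrite (pihomog_ne0 ne)].
Qed.

Section Complement.

Variable J : S -> Prop.
Hypotheses (idJ : is_ideal J) (radJ : forall f n, J (f ^+ n) -> J f).
Hypothesis J1 : ~ J 1.

(** Membership of 1 is left to maximality, so that the union of the empty chain is a system and
    Zorn's lemma applies. *)
Definition homog_system (M : S -> Prop) : Prop :=
  (forall f g, M f -> M g -> M (f * g)) /\
  forall f, M f -> (exists d, f \is d.-homog) /\ ~ J f.

Lemma ex_maximal_homog_system : exists M, [/\ homog_system M, M 1 &
  forall f d, f \is d.-homog -> M f \/ exists2 h, M h & J (f * h)].
Proof.
have [F FM totF|M [sysM maxM]] := @classical_sets.Zorn_bigcup S homog_system.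
  split=> [f g [A FA Af] [B FB Bg]|f [A FA Af]]; last first.
    by have [_ +] := FM _ FA; apply.
  have [AB|BA] := totF _ _ FA FB.
    by exists B => //; have [+ _] := FM _ FB; apply=> //; apply: AB.
  by exists A => //; have [+ _] := FM _ FA; apply=> //; apply: BA.
pose M1 h := M h \/ h = 1.
have M1M f g : M1 f -> M1 g -> M1 (f * g).
  move=> [Mf|->] [Mg|->]; rewrite ?mulr1 ?mul1r; [left|left|left|right] => //.
  by case: sysM => MM _; apply: MM.
have M1J h : M1 h -> (exists d, h \is d.-homog) /\ ~ J h.
  by move=> [|->]; [case: sysM => _; apply|split=> //; exists 0%N; apply: dhomog1].
have alt f d : f \is d.-homog -> M f \/ exists2 h, M1 h & J (f * h).
  move=> fd; have [|nJ] := EM (exists2 h, M1 h & J (f * h)); first by right.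
  left; apply: contrapT => nMf.
  (* The system generated by M, 1 and f. If f^n h were in J with n > 0, then (f h)^n would be too,
     hence f h since J is radical. *)
  pose B x := exists n, exists2 h, M1 h & x = f ^+ n * h.
  apply: (maxM B).
    split=> [x Mx|sub]; first by exists 0%N, x; [left|rewrite mul1r].
    by apply: nMf; apply: sub; exists 1%N, 1; [right|rewrite mulr1].
  split=> [x y [n [h Mh ->]] [m [h' Mh' ->]]|x [n [h Mh ->]]].
    by exists (n + m)%N, (h * h'); [apply: M1M|rewrite exprD mulrACA].
  have [[e he] nJh] := M1J _ Mh; split.
    by exists (d * n + e)%N; apply: dhomogM => //; apply: dhomogMn.
  case: n => [|n] Jfh; first by apply: nJh; rewrite mul1r in Jfh.
  apply: nJ; exists h => //; apply: (radJ (n := n.+1)).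
  by rewrite exprMn [h ^+ _]exprS mulrA; apply: idealMr.
have M_1 : M 1.
  have [//|[h /M1J[_ nJh]]] := alt 1 0%N (dhomog1 _ _).
  by rewrite mul1r.
have M1E h : M1 h -> M h by case=> // ->.
exists M; split=> // f d /alt[|[h /M1E Mh Jfh]]; [by left|by right; exists h].
Qed.

Variable M : S -> Prop.
Hypotheses (sysM : homog_system M) (M_1 : M 1)
  (maxM : forall f d, f \is d.-homog -> M f \/ exists2 h, M h & J (f * h)).

(** The elements that fall into J after inverting M; by maximality a homogeneous element lies either
    here or in M. *)
Let N f := exists2 h, M h & J (f * h).

Let idN : is_ideal N.
Proof.
split=> [|f g [h Mh Jh] [h' Mh' Jh']|f g [h Mh Jh]].
- by exists 1 => //; rewrite mul0r; apply: ideal0.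
- exists (h * h'); first by case: sysM => MM _; apply: MM.
  rewrite mulrDl mulrA [h * h']mulrC mulrA.
  by apply: idealD => //; apply: idealMr.
- by exists h => //; rewrite -mulrA; apply: idealMl.
Qed.

Let N_M f : N f -> ~ M f.
Proof.
move=> [h Mh Jfh] Mf; have [MM MJ] := sysM.
by have [] := MJ _ (MM _ _ Mf Mh).
Qed.

(** N need not be homogeneous: J will be defined by dehomogenization, which sends the product of all
    x_j - 1 to 0 on every chart. Hence the condition on each homogeneous part. *)
Definition homog_prime f : Prop := forall d, N (part d f).

Lemma homog_prime_homog f d : f \is d.-homog -> homog_prime f <-> N f.
Proof.
move=> fd; split=> [/(_ d)|Nf e]; first by rewrite pihomog_dE.
have [<-|ne] := eqVneq d e; first by rewrite pihomog_dE.
by rewrite (pihomog_ne0 ne fd); apply: ideal0.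
Qed.

Lemma homog_prime_is_ideal : is_ideal homog_prime.
Proof.
split=> [d|f g Nf Ng d|f g Ng d].
- by rewrite linear0; apply: ideal0.
- by rewrite linearD; apply: idealD => //; [exact: Nf|exact: Ng].
rewrite (@pihomogM (maxn (msize f) (msize g))) ?leq_maxl ?leq_maxr //.
do 2 (apply: ideal_sum => // ? _); apply: idealMl => //; exact: Ng.
Qed.

Lemma homog_prime_pihomog f d : homog_prime f -> homog_prime (part d f).
Proof. by move=> Nf; apply/(homog_prime_homog (pihomogP mdeg d f)). Qed.

Lemma homog_prime_proper : ~ homog_prime 1.
Proof. by move/(homog_prime_homog (dhomog1 _ _))/N_M. Qed.

(** The highest parts of f and g outside N are in M, hence so is their product; yet the other terms
    of the same degree in f * g all lie in N. *)
Lemma homog_prime_prime f g :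
  homog_prime (f * g) -> homog_prime f \/ homog_prime g.
Proof.
move=> Nfg; apply: contrapT => /not_orP[nf ng].
have top h : ~ homog_prime h ->
    exists d, ~ N (part d h) /\ forall e, (d < e)%N -> N (part e h).
  move=> /existsNP nh; have [d nd|d nd dmax] := ex_max_nat (b := msize h) _ nh.
    rewrite leqNgt; apply/negP => hd; apply: nd.
    rewrite (_ : part d h = 0); first exact: ideal0.
    rewrite pihomogE big_seq_cond big1 // => m /andP[/msize_mdeg_lt mh /eqP md].
    by have := ltn_trans mh hd; rewrite md ltnn.
  exists d; split=> // e de; apply: contrapT => /dmax; by rewrite leqNgt de.
have [d [nd dtop]] := top f nf; have [e [ne etop]] := top g ng.
have Md : M (part d f) by case: (maxM (pihomogP mdeg d f)).
have Me : M (part e g) by case: (maxM (pihomogP mdeg e g)).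
suff /N_M : N (part d f * part e g) by apply; case: sysM => MM _; apply: MM.
have [K KE] : exists K, K = maxn (maxn (msize f) (msize g)) (maxn d e).+1.
  by eexists.
have [fK gK] : (msize f <= K)%N /\ (msize g <= K)%N.
  by rewrite KE !leq_max !leqnn !orbT.
have [dK eK] : (d < K)%N /\ (e < K)%N.
  by rewrite KE !leq_max !ltnS !leq_max !leqnn !orbT.
have := Nfg (d + e)%N; rewrite (pihomogM _ fK gK) (bigD1 (Ordinal dK)) //=.
rewrite (bigD1 (Ordinal eK)) //= -addrA => Nsum.
rewrite -[_ * _](addrK (
  \sum_(i < K | (d + i == d + e)%N && (i != Ordinal eK)) part d f * part i g +
  \sum_(i < K | i != Ordinal dK)
    \sum_(j < K | (i + j == d + e)%N) part i f * part j g)).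
apply: idealB => //; apply: idealD => //; apply: ideal_sum => // i.
  by move=> /andP[/eqP/addnI ie]; rewrite -val_eqE /= ie eqxx.
move=> id; apply: ideal_sum => // j /eqP ij.
have [di|] := ltnP d i; first by apply: idealMr => //; apply: dtop.
rewrite leq_eqVlt => /orP[/eqP E|lt_id]; first by case/eqP: id; apply: val_inj.
apply: idealMl => //; apply: etop; rewrite -(ltn_add2l i) ij.
by rewrite ltn_add2r.
Qed.

End Complement.

(* The chosen M is a maximal multiplicative system of homogeneous elements off
   (I_Y : x_i g), so its complement is a minimal prime of I_Y. *)
Lemma ex_component_avoiding (Y : closed_subscheme k r) g d :
    is_reduced Y -> g \is d.-homog -> ~ H0 Y d g ->
  exists P : proj_point k r, [/\ scheme_support Y P, ~ P g &
    irreducible_component Y (fun Q => forall f, P f -> Q f)].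
Proof.
move=> redY gd; have idY i := chart_ideal Y i.
move=> /not_andP[//|/existsNP[i nYg]].
pose IY f := forall j, Y j (dehom j f).
have dehomX j f n : dehom j (f ^+ n) = dehom j f ^+ n by rewrite /dehom rmorphXn.
have idIY : is_ideal IY.
  split=> [j|f h If Ih j|f h Ih j].
  - by rewrite /dehom rmorph0; apply: ideal0.
  - by rewrite dehomD; apply: idealD.
  - by rewrite dehomM; apply: idealMl.
have radIY f n : IY (f ^+ n) -> IY f.
  by move=> If j; apply: (redY _ _ n); rewrite -dehomX.
have satIY e f : f \is e.-homog -> IY f -> satideal Y f.
  move=> fe If e'; have [<-|ne] := eqVneq e e'; first by rewrite pihomog_dE.
  rewrite (pihomog_ne0 ne fe); split; first exact: dhomog0.
  by move=> j; apply: (ideal0 idIY).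
(* The factor g keeps g out of the prime, and ['X_i] makes the prime relevant. *)
pose J h := IY ('X_i * g * h).
have idJ : is_ideal J.
  split=> [|f h|f h]; rewrite /J ?mulr0 ?mulrDr ?[_ * (f * h)]mulrCA.
  - exact: ideal0 idIY.
  - exact: idealD idIY _ _.
  - exact: idealMl.
have radJ f n : J (f ^+ n) -> J f.
  move=> Jf; apply: (radIY _ n.+1); rewrite exprMn [f ^+ _]exprSr mulrA.
  apply: (idealMr idIY); rewrite exprS -mulrA mulrCA; exact: (idealMl idIY).
have nJ1 : ~ J 1.
  by move/(_ i); rewrite mulr1 dehomM -['X_i]expr1 dehomXi mul1r.
have [M [sysM M1 maxM]] := ex_maximal_homog_system idJ radJ nJ1.
pose N f := exists2 h, M h & J (f * h).
pose P := homog_prime J M.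
have PE e f : f \is e.-homog -> P f <-> N f.
  exact: (homog_prime_homog idJ sysM M1).
(* If f m is in J, then (x_i g m)^2 = (h m)(x_i g f m) is in [IY], so m is in J, against m in M. *)
have nP f e h : f \is e.-homog -> 'X_i * g = f * h -> ~ P f.
  move=> fe E /(PE _ _ fe)[m Mm Jfm]; case: sysM => _ /(_ _ Mm)[_]; apply.
  apply: (radIY _ 2); rewrite expr2 {1}E.
  have mulE (a b c e' : S) : a * b * c * (e' * c) = e' * (a * c) * (b * c).
    by rewrite mulrC -!mulrA [c * (a * _)]mulrCA.
  by rewrite mulE; apply: (idealMr idIY).
have nPXi : ~ P 'X_i by apply: (nP _ 1%N g) => //; rewrite dhomogX; apply/eqP/mdeg1.
have nPg : ~ P g by apply: (nP _ d 'X_i) => //; rewrite mulrC.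
have prP := homog_prime_prime idJ sysM M1 maxM.
pose pP := ProjPoint (homog_prime_is_ideal idJ sysM M1)
  (fun f e => @homog_prime_pihomog J idJ M sysM M1 f e)
  (homog_prime_proper idJ sysM M1)
  prP (ex_intro _ i nPXi).
have supP : scheme_support Y pP.
  move=> f Yf e; exists 1 => //; rewrite mulr1 /J.
  by apply: (idealMl idIY); case: (Yf e).
exists pP; split; [exact: supP|exact: nPg|split].
- split; first by exists pP.
  move=> C D [T [_ TE]] [T' [_ TE']] CD.
  have [/TE CP|/TE' DP] := CD pP (fun _ => id); [left|right] => Q PQ.
    by apply/TE => f /CP; apply: PQ.
  by apply/TE' => f /DP; apply: PQ.
- by move=> Q PQ f /supP; apply: PQ.
move=> W [_ irrW] supW PW.
(* Some f h with h in M lies in J, so f c is in I_Y for c = x_i g h, which is outside P. The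
   irreducible W lies in V(f) or V(c), and its point P excludes V(c). *)
have vanish Q e f : W Q -> f \is e.-homog -> P f -> Q f.
  move=> WQ fe /(PE _ _ fe)[h Mh Jfh].
  have [_ /(_ _ Mh)[[e' he'] nJh]] := sysM.
  have nPh : ~ P h.
    move=> /(PE _ _ he')[h' Mh' Jhh']; have [MM MJ] := sysM.
    by have [] := MJ _ (MM _ _ Mh Mh').
  pose c := 'X_i * g * h.
  have nPc : ~ P c.
    by move/prP => [/prP[]|].
  have Xi1 : ('X_i : S) \is 1.-homog by rewrite dhomogX; apply/eqP/mdeg1.
  have chom : c \is (1 + d + e')%N.-homog by apply: dhomogM he'; apply: dhomogM gd.
  pose V (f' : S) (Q' : proj_point k r) := Q' f'.
  have closedV e0 f' : f' \is e0.-homog -> zariski_closed (V f').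
    move=> fe0; exists (eq f'); split=> [_ <-|Q']; first by exists e0.
    by split=> [Qf _ <-|/(_ _ erefl)].
  have Wfc Q' : W Q' -> V f Q' \/ V c Q'.
    move=> WQ'; apply: point_prime; apply: supW WQ' _ _.
    apply: (satIY (e + (1 + d + e'))%N); first exact: dhomogM.
    by rewrite /c mulrCA.
  have [Wf|Wc] := irrW _ _ (closedV _ _ fe) (closedV _ _ chom) Wfc.
    exact: Wf.
  by case: nPc; apply: (Wc pP); apply: PW.
move=> Q WQ f Pf.
rewrite [f](@pihomog_partitionE _ _ mdeg (msize f)) //.
apply: ideal_sum => [|e _]; first exact: point_is_ideal.
apply: (vanish _ e) => //; first exact: pihomogP.
by apply: (point_homog (p := pP)).
Qed.

End HomogeneousPrimes.

(** * Dimension of quotients of spaces of forms *)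

Section Dimension.

Variables (k : closedFieldType) (r d : nat) (W U : {mpoly k[r.+1]} -> Prop).
Hypotheses (Wd : forall f, W f -> f \is d.-homog) (U0 : U 0).
Hypothesis UZ : forall (c : k) f, U f -> U (c *: f).

Let independent m (e : 'I_m -> {mpoly k[r.+1]}) :=
  (forall i, W (e i)) /\
  forall c : 'I_m -> k, U (\sum_i c i *: e i) -> forall i, c i = 0.

Let independent_bound m e :
  @independent m e -> (m <= #|{: 'X_{1..r.+1 < d.+1}}|)%N.
Proof.
move=> [eW free]; rewrite leqNgt; apply/negP => lt_m.
pose A := \matrix_(i < m, j < #|{: 'X_{1..r.+1 < d.+1}}|)
  (e i)@_(enum_val j : 'X_{1..r.+1 < d.+1}).
have : kermx A != 0.
  rewrite kermx_eq0 /row_free neq_ltn; apply/orP; left.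
  exact: leq_ltn_trans (rank_leq_col A) lt_m.
case/rowV0Pn => v /sub_kermxP vA; apply/negP; rewrite negbK; apply/eqP/rowP => i.
rewrite mxE; apply: (free (v 0)); rewrite (_ : \sum_(j < m) v 0 j *: e j = 0) //.
apply/mpolyP => m0; rewrite raddf_sum mcoeff0 /=.
have [md|nd] := eqVneq (mdeg m0) d.
  have lt_m0 : (mdeg m0 < d.+1)%N by rewrite md.
  move/rowP/(_ (enum_rank (BMultinom lt_m0))): vA; rewrite !mxE; apply: etrans.
  by apply: eq_bigr => j _; rewrite mxE enum_rankK mcoeffZ.
by rewrite big1 // => j _; rewrite mcoeffZ (dhomog_nemf_coeff (Wd (eW j))) ?mulr0.
Qed.

(** A largest family independent modulo U is a basis: in the relation obtained by adjoining f, the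
    coefficient of f cannot vanish. *)
Lemma ex_quotient_dim : exists m, quotient_dim W U m.
Proof.
have [m [e [eW free]] mmax] : exists2 m, (exists e, @independent m e) &
    forall m', (exists e, @independent m' e) -> (m' <= m)%N.
  apply: ex_max_nat => [m [e]|]; first exact: independent_bound.
  by exists 0%N, (fun=> 0); split=> [[]|c _ []].
exists m, e; split=> // f Wf.
have : ~ independent (fun i : 'I_m.+1 =>
    if unlift ord0 i is Some j then e j else f).
  by move=> ind; have := mmax m.+1 (ex_intro _ _ ind); rewrite ltnn.
move=> /not_andP[[] i|/existsNP[c /not_implyP[Uc /existsNP[i ci]]]].
  by case: unliftP.
move: Uc; rewrite big_ord_recl unlift_none; under eq_bigr do rewrite liftK.
move=> Uc; have c0 : c ord0 != 0.
  apply/eqP => c0; apply: ci; rewrite c0 scale0r add0r in Uc.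
  by case: (unliftP ord0 i) => [j|] -> //; apply: (free _ Uc j).
exists (fun j => - (c ord0)^-1 * c (lift ord0 j)).
have := UZ (c ord0)^-1 Uc; rewrite scalerDr scalerA mulVf // scale1r scaler_sumr.
rewrite -sumrN; congr (U (_ + _)); apply: eq_bigr => j _.
by rewrite mulNr scaleNr opprK scalerA.
Qed.

End Dimension.

(** * Saturated ideals and the conclusion *)

Lemma satideal_is_ideal (k : closedFieldType) r (Y : closed_subscheme k r) :
  is_ideal (satideal Y).
Proof.
have idY i := chart_ideal Y i.
have H0D d f g : H0 Y d f -> H0 Y d g -> H0 Y d (f + g).
  move=> [fd Yf] [gd Yg]; split=> [|i]; first exact: rpredD.
  by rewrite dehomD; apply: idealD.
have H0_0 d : H0 Y d 0.
  by split=> [|i]; [exact: dhomog0|rewrite /dehom rmorph0; apply: ideal0].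
split=> [d|f g Yf Yg d|f g Yg d].
- by rewrite linear0.
- by rewrite linearD; apply: H0D.
rewrite (@pihomogM _ _ (maxn (msize f) (msize g))) ?leq_maxl ?leq_maxr //.
apply: (big_ind (H0 Y d) (H0_0 d) (H0D d)) => i _.
apply: (big_ind (H0 Y d) (H0_0 d) (H0D d)) => j /eqP <-.
split=> [|l]; first by apply: dhomogM; apply: pihomogP.
by rewrite dehomM; apply: idealMl => //; case: (Yg j).
Qed.

Lemma homog_satidealE (k : closedFieldType) r (Y : closed_subscheme k r) d f :
  f \is d.-homog -> satideal Y f <-> H0 Y d f.
Proof.
move=> fd; split=> [/(_ d)|Yf e]; first by rewrite pihomog_dE.
have [<-|ne] := eqVneq d e; first by rewrite pihomog_dE.
rewrite (pihomog_ne0 ne fd); split=> [|i]; first exact: dhomog0.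
by rewrite /dehom rmorph0; apply: ideal0; apply: chart_ideal.
Qed.

Theorem theorem4p1 (k : closedFieldType) (r : nat)
    (X Gamma : closed_subscheme k r)
    (hX : is_nondegenerate X)
    (hGamma_red : is_reduced Gamma)
    (hGamma_span : forall Z, irreducible_component Gamma Z -> spans Z)
    (p : nat) (F : free_resolution k r)
    (hTor : ~ tor_map_surjective F (satideal (schemeU X Gamma)) (satideal X)
                p (Posz (p + 2))) :
  exists d : nat,
    quotient_dim (H0 (schemeI X Gamma) 2) (H0 Gamma 2) d /\ (p < d)%N.
Proof.
have idY (Y : closed_subscheme k r) i := chart_ideal Y i.
have [||c f [fd Yf]|d dimd] :=
    @ex_quotient_dim k r 2 (H0 (schemeI X Gamma) 2) (H0 Gamma 2).
- by move=> f [].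
- by split=> [|i]; [exact: dhomog0|rewrite /dehom rmorph0; apply: ideal0].
- split=> [|i]; first exact: dhomogZ.
  by rewrite /dehom linearZ /= -mul_mpolyC; apply: idealMl.
exists d; split=> //; rewrite ltnNge; apply/negP => dp; apply: hTor.
have [G linG] := linear_resolution k r.
apply: (tor_map_surjective_indep (G := G)); try exact: satideal_is_ideal.
move=> v [vX vcyc].
have v2 a : v 0 a \is 2.-homog.
  apply/(zhomogP 2) => m /(vX a).2; rewrite linG => /eqP.
  by rewrite -PoszD eqz_nat addnC eqn_add2l => /eqP ->.
have vH a : H0 X 2 (v 0 a) by apply/homog_satidealE => //; case: (vX a).
(* v will be a cycle for the union itself, so it lifts its own class and the correcting boundary is
   0. *)
exists v; last first.
  exists 0 => [a|]; last by rewrite subrr mul0mx.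
  rewrite mxE; split; first by apply: ideal0; apply: satideal_is_ideal.
  by move=> m; rewrite msupp0.
split=> // a; split; last by case: (vX a).
apply/(homog_satidealE _ (v2 a)); split=> // i; split; first by case: (vH a).
suff [_ +] : H0 Gamma 2 (v 0 a) by apply.
apply: contrapT => nYv.
have [P [supP nPv /hGamma_span spanP]] :=
  ex_component_avoiding hGamma_red (v2 a) nYv.
have primeP : is_prime_ideal P.
  by split; [exact: point_is_ideal|exact: point_proper|exact: point_prime].
pose Z (x : 'I_r.+1 -> k) := forall g, P g -> g.@[x] = 0.
have vanishP g : vanishes Z g -> P g.
  move=> Zg; apply: contrapT => /(nullstellensatz_prime primeP)[x Zx].
  by rewrite Zg ?eqxx.
have irrZ f g : vanishes Z (f * g) -> vanishes Z f \/ vanishes Z g.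
  by move=> /vanishP/point_prime[] Pf; [left|right] => x; apply.
(* Spanning is known for the set of homogeneous primes containing P, and a form in P lies in all of
   them. *)
have spanZ l : l \is 1.-homog -> vanishes Z l -> l = 0.
  by move=> l1 /vanishP Pl; apply: (spanP l l1) => Q; apply.
have [e [eW _ eG]] := dimd.
(* The entries of v are in I_X, hence in the ideal of the intersection, with zero component along
   Gamma. *)
have /choice[c cE] b : exists c : 'I_d -> k,
    H0 Gamma 2 (v 0 b - \sum_i c i *: e i).
  apply: eG; split=> // j; exists (dehom j (v 0 b)), 0; rewrite addr0.
  by split=> //; [case: (vH b)|apply: ideal0].
pose tau i : 'rV[k]_(rk G p) := \row_b c b i.
(* Quadrics of I_Gamma lie in P and vanish on Z, so there the expansion agrees with v. *)
have tauE x : Z x -> \sum_i (e i).@[x] *: tau i = map_mx (meval x) v.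
  move=> Zx; apply/rowP => b; rewrite summxE mxE.
  have : (v 0 b - \sum_i c b i *: e i).@[x] = 0.
    by apply: Zx; apply: supP; apply/homog_satidealE => //; case: (cE b).
  rewrite mevalB => /eqP; rewrite subr_eq0 => /eqP ->; rewrite raddf_sum /=.
  by apply: eq_bigr => j _; rewrite mevalZ !mxE mulrC.
have syz x : Z x -> syzygy_at e tau x.
  clearbody tau; clear -vcyc tauE => Zx; rewrite /syzygy_at.
  case: p => [//|p] in v tau vcyc tauE *.
  by rewrite tauE // -map_mxM vcyc map_mx0.
apply: nPv; apply: vanishP => x Zx.
have := linear_syzygy_vanishing linG irrZ spanZ dp syz Zx.
by rewrite tauE // => /rowP/(_ a); rewrite !mxE.
Qed.
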